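(* For every knot $K$ there exists an integer $n \ge 0$ such that $K$ can be embedded in the $n$-th iteration $M_n$ of the Menger Sponge; that is, there is a simple closed curve contained in the one-skeleton of $M_n$ which, as a knot in $\mathbb{R}^3$, is isotopic to $K$.
   Context: Knots are tame knots in $\mathbb{R}^3$, considered up to ambient isotopy. The iterations of the Menger Sponge: $M_0 = [0,1]^3$. Given $M_n$, a union of closed cubes of side length $3^{-n}$, divide each of these cubes into $27$ equal closed cubes of side length $3^{-(n+1)}$, discard the central cube of each of the six faces and the interior central cube (seven cubes), and keep the other $20$ closed cubes; $M_{n+1}$ is the union of all the closed cubes kept. The Menger Sponge is $M=\bigcap_{n\ge 0} M_n$. The one-skeleton of $M_n$ is the union of the edges of the boundary of $M_n$, i.e. of those edges of the closed cubes of side length $3^{-n}$ constituting $M_n$ that lie in the boundary of $M_n$. A knot $K$ is said to be embedded in the finite iteration $M_n$ if some simple closed curve in the one-skeleton of $M_n$ is isotopic to $K$ as a knot in $\mathbb{R}^3$. *)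

(* Defs.v *)
From HB Require Import structures.
From mathcomp Require Import all_boot all_order all_algebra.
From mathcomp Require Import all_classical all_reals all_analysis.

Set Implicit Arguments.
Unset Strict Implicit.
Unset Printing Implicit Defensive.

Import Order.TTheory GRing.Theory Num.Theory.
Import numFieldNormedType.Exports.

Local Open Scope classical_set_scope.
Local Open Scope ring_scope.

Definition boundary (T : topologicalType) (A : set T) : set T :=
  closure A `\` interior A.

Definition homeomorphism (T U : topologicalType) (f : T -> U) : Prop :=
  continuous f /\
  exists g : U -> T, [/\ continuous g, cancel f g & cancel g f].

Section Knots.
Variable R : realType.
Local Notation E3 := 'rV[R]_3.

(* A circle is a quotient of [0, 1]: the endpoints are identified, and there
   are no other coincidences. *)
Definition simple_closed_curve (C : set E3) : Prop :=
  exists g : R -> E3,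
    [/\ {within `[0, 1], continuous g},
        g 0 = g 1,
        {in `[0, 1[ &, injective g} &
        C = g @` `[0, 1] ].

(* Knots are taken as unoriented subsets of space. *)
Definition ambient_isotopic (K L : set E3) : Prop :=
  exists H : R * E3 -> E3,
    [/\ {within `[0, 1] `*` [set: E3], continuous H},
        forall t, t \in `[0, 1] -> homeomorphism (fun x => H (t, x)),
        forall x, H (0, x) = x &
        (fun x => H (1, x)) @` K = L].

(* The successor ordS is cyclic, so that the last edge closes the polygon. *)
Definition polygon_pt n (p : 'I_n -> E3) (i : 'I_n) (s : R) : E3 :=
  (1 - s) *: p i + s *: p (ordS i).

Definition polygon n (p : 'I_n -> E3) : set E3 :=
  [set x | exists i, exists2 s, s \in `[0, 1[ & x = polygon_pt p i s].

Definition simple_closed_polygon (P : set E3) : Prop :=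
  exists n (p : 'I_n -> E3),
    [/\ (2 < n)%N,
        (forall i j s t, s \in `[0, 1[ -> t \in `[0, 1[ ->
          polygon_pt p i s = polygon_pt p j t -> i = j /\ s = t) &
        P = polygon p].

Definition tame_knot (K : set E3) : Prop :=
  simple_closed_curve K /\
  exists P, simple_closed_polygon P /\ ambient_isotopic K P.

End Knots.

(* The 27 subcubes of a cube are indexed by their digits d in {0, 1, 2}^3. *)
Definition central_subcube (d : {ffun 'I_3 -> 'I_3}) : Prop :=
  forall i, d i = 1%N :> nat.

Definition face_central_subcube (d : {ffun 'I_3 -> 'I_3}) : Prop :=
  exists2 i, d i = 0%N :> nat \/ d i = 2%N :> nat
           & forall j, j != i -> d j = 1%N :> nat.

(* The closed cubes constituting the n-th iteration are given by their lowest
   corners, in units of the side length 3 ^- n. *)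
Fixpoint menger_corner (n : nat) : set {ffun 'I_3 -> nat} :=
  if n is m.+1 then
    [set c | exists a d,
      [/\ menger_corner m a,
          ~ central_subcube d,
          ~ face_central_subcube d &
          c = [ffun i => 3 * a i + d i]%N]]
  else [set [ffun=> 0%N]].

Section Menger.
Variable R : realType.
Local Notation E3 := 'rV[R]_3.

Definition cube (n : nat) (a : {ffun 'I_3 -> nat}) : set E3 :=
  [set x | forall i, (a i)%:R / 3 ^+ n <= x 0 i <= (a i).+1%:R / 3 ^+ n].

Definition menger (n : nat) : set E3 :=
  \bigcup_(a in menger_corner n) cube n a.

(* The edge in direction k; the bits e j, for j != k, choose among the four
   parallel edges, and e k is irrelevant. *)
Definition cube_edge (n : nat) (a : {ffun 'I_3 -> nat}) (k : 'I_3)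
    (e : 'I_3 -> bool) : set E3 :=
  [set x | cube n a x /\
           forall j, j != k -> x 0 j = (a j + e j)%:R / 3 ^+ n].

Definition one_skeleton (n : nat) : set E3 :=
  [set x | exists a k e,
    [/\ menger_corner n a,
        cube_edge n a k e `<=` boundary (menger n) &
        cube_edge n a k e x]].

End Menger.

(* Main.v *)
From HB Require Import structures.
Require Import Defs.
From mathcomp Require Import all_boot all_order all_algebra.
From mathcomp Require Import all_classical all_reals all_analysis.
From mathcomp Require Import ring lra zify.

(* A line parallel to an axis whose two transverse coordinates have ternary
   digits 0 and 2 only lies in every M_n, because a removed cube has at least
   two digits 1 at some level.  So it is enough to deform the polygon into an
   axis-parallel one: a coordinatewise increasing map then carries the finitely
   many coordinates of its vertices to such Cantor numbers, with last digit 2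
   so that the edges are in the boundary of M_n.

   An edge in direction v + w is replaced by a fine zigzag of edges parallel to
   v and w; taking for v one coordinate component of the edge at a time leaves
   only axis-parallel edges.  Each tooth is pushed across a triangle that meets
   the rest of the polygon only in the base vertices; near an endpoint of the
   edge this is ensured by choosing the side of the edge on which the teeth lie.

   All ambient isotopies come from one principle: if a displacement d of a set
   is Lipschitz with a constant k < 1, it extends to space with the same
   constant, and x + t d(x) is a homeomorphism for every t in [0, 1].  A family
   x + t d on which d is M-Lipschitz in terms of the displaced points is cut
   into steps of size less than 1 / M. *)

Set Implicit Arguments.
Unset Strict Implicit.
Unset Printing Implicit Defensive.

Import Order.TTheory GRing.Theory Num.Theory.
Import numFieldNormedType.Exports.

Local Open Scope classical_set_scope.
Local Open Scope ring_scope.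

(** * Lipschitz displacements and ambient isotopies *)

(** Joins completeness with the normed structure of matrices, so that the Banach fixed point theorem
    applies to row vectors. *)
HB.instance Definition _ (R : realType) (m n : nat) :=
  Complete.on 'M[R]_(m, n).

Section Isotopy.
Variable R : realType.
Local Notation E3 := 'rV[R]_3.

Lemma ler_coord_norm n (x : 'rV[R]_n) i : `|x 0 i| <= `|x|.
Proof.
rewrite [leRHS]/Num.norm /= mx_normrE.
by apply: (le_trans _ (le_bigmax _ _ (0, i))).
Qed.

Lemma ler_rV_norm n (x : 'rV[R]_n) (c : R) :
  0 <= c -> (forall i, `|x 0 i| <= c) -> `|x| <= c.
Proof.
move=> c0 xc; rewrite [leLHS]/Num.norm /= mx_normrE.
by apply/bigmax_leP; split => // -[i j] _ /=; rewrite ord1.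
Qed.

Lemma continuous_within_comp (T U V : topologicalType) (A : set U)
    (f : T -> U) (g : U -> V) :
  continuous f -> (forall x, A (f x)) -> {within A, continuous g} ->
  continuous (g \o f).
Proof.
move=> cf fA /subspace_continuousP cg x.
move=> W /(cg _ (fA x)) gW.
have : nbhs x (f @^-1` [set y | A y -> W (g y)]) by exact: cf gW.
by apply: filterS => y; apply; exact: fA.
Qed.

Lemma continuous_pair (T U V : topologicalType) (f : T -> U) (g : T -> V) :
  continuous f -> continuous g -> continuous (fun x => (f x, g x)).
Proof.
move=> cf cg x.
exact: (@cvg_pair _ _ _ (nbhs x) (nbhs (f x)) (nbhs (g x)) _ _ _ f g
  (cf x) (cg x)).
Qed.

Lemma continuous_lipschitz (V W : normedModType R) (f : V -> W) (c : R) :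
  (forall x y, `|f x - f y| <= c * `|x - y|) -> continuous f.
Proof.
move=> fc x; apply/cvgrPdist_lt => e e0.
have c1 : 0 < `|c| + 1 by rewrite ltr_wpDl.
near=> y.
apply: le_lt_trans (fc _ _) _.
apply: (@le_lt_trans _ _ ((`|c| + 1) * `|x - y|)).
  by rewrite ler_wpM2r // ler_wpDr // ler_norm.
rewrite -ltr_pdivlMl // mulrC; near: y.
by apply: cvgr_dist_lt => //; rewrite divr_gt0.
Unshelve. all: end_near. Qed.

Lemma homeomorphism_comp (T U V : topologicalType) (f : T -> U) (g : U -> V) :
  homeomorphism f -> homeomorphism g -> homeomorphism (g \o f).
Proof.
move=> [cf [f' [cf' fK f'K]]] [cg [g' [cg' gK g'K]]]; split.
  by move=> x; apply: continuous_comp; [exact: cf|exact: cg].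
exists (f' \o g'); split.
- by move=> x; apply: continuous_comp; [exact: cg'|exact: cf'].
- by move=> x /=; rewrite gK fK.
- by move=> x /=; rewrite f'K g'K.
Qed.

Lemma homeomorphism_id (T : topologicalType) : homeomorphism (@id T).
Proof. by split; [|exists id; split] => // x; exact: cvg_id. Qed.

Lemma ambient_isotopic_refl (K : set E3) : ambient_isotopic K K.
Proof.
exists snd; split.
- by apply: continuous_subspaceT => x; exact: cvg_snd.
- by move=> t _; exact: homeomorphism_id.
- by [].
- by rewrite image_id.
Qed.

Definition clamp (t : R) : R := Num.max 0 (Num.min 1 t).

Lemma clampP t : clamp t \in `[0, 1].
Proof. by rewrite in_itv /= /clamp le_max lexx ge_max ler01 ge_min lexx. Qed.

Lemma continuous_clamp : continuous clamp.
Proof.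
move=> x; apply: continuous_max; first exact: cvg_cst.
by apply: continuous_min; [exact: cvg_cst|exact: cvg_id].
Qed.

(* Clamping runs the two isotopies one after the other without gluing. *)
Lemma ambient_isotopic_trans (K L M : set E3) :
  ambient_isotopic K L -> ambient_isotopic L M -> ambient_isotopic K M.
Proof.
move=> [F [cF hF F0 F1]] [G [cG hG G0 G1]].
pose H (tx : R * E3) := G (clamp (2 * tx.1 - 1), F (clamp (2 * tx.1), tx.2)).
have c2 : continuous (fun tx : R * E3 => clamp (2 * tx.1)).
  move=> x; apply: (@continuous_comp _ _ _ (fun tx : R * E3 => 2 * tx.1) clamp).
    by apply: cvgM; [exact: cvg_cst|exact: cvg_fst].
  exact: continuous_clamp.
have c21 : continuous (fun tx : R * E3 => clamp (2 * tx.1 - 1)).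
  move=> x; apply: (@continuous_comp _ _ _ (fun tx : R * E3 => 2 * tx.1 - 1)
    clamp).
    apply: cvgB; last exact: cvg_cst.
    by apply: cvgM; [exact: cvg_cst|exact: cvg_fst].
  exact: continuous_clamp.
have mem (t : R) (x : E3) : t \in `[0, 1] -> (`[0, 1] `*` setT) (t, x).
  by move=> ht; split.
exists H; split.
- apply: continuous_subspaceT.
  pose f (tx : R * E3) := (clamp (2 * tx.1), tx.2).
  pose g (tx : R * E3) := (clamp (2 * tx.1 - 1), F (f tx)).
  have cf : continuous f.
    by apply: continuous_pair => // x; exact: cvg_snd.
  have cFf : continuous (F \o f).
    by apply: continuous_within_comp cf _ cF => y; exact/mem/clampP.
  have cg : continuous g.
    exact: continuous_pair.
  have : continuous (G \o g).
    by apply: continuous_within_comp cg _ cG => y; exact/mem/clampP.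
  by [].
- move=> t _.
  by apply: (homeomorphism_comp (hF _ (clampP (2 * t)))
    (hG _ (clampP (2 * t - 1)))).
- have c0 : clamp (2 * 0) = 0.
    by rewrite mulr0 /clamp min_r ?ler01 // maxxx.
  have c1 : clamp (2 * 0 - 1) = 0.
    by rewrite mulr0 sub0r /clamp min_r ?max_l //; lra.
  by move=> x; rewrite /H /= c0 c1 F0 G0.
- have c0 : clamp (2 * 1) = 1.
    by rewrite mulr1 /clamp min_l ?max_r //; lra.
  have c1 : clamp (2 * 1 - 1) = 1.
    by rewrite mulr1 /clamp min_l ?max_r //; lra.
  rewrite -G1 -F1 image_comp; apply: eq_imagel => x _.
  by rewrite /H /= c0 c1.
Qed.

Lemma simple_closed_curve_isotopic (K L : set E3) :
  simple_closed_curve K -> ambient_isotopic K L -> simple_closed_curve L.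
Proof.
move=> [g [cg g01 ginj ->]] [H [cH hH H0 <-]].
have [cH1 [h [_ Hh _]]] : homeomorphism (fun x => H (1, x)).
  by apply: hH; rewrite in_itv /= ler01 lexx.
exists (fun s => H (1, g s)); split.
- exact: (fun s => continuous_comp (cg s) (cH1 (g s))).
- by rewrite g01.
- by move=> s t sI tI /(can_inj Hh) /ginj; apply.
- by rewrite image_comp.
Qed.

(** A solution of [x + f x = y] is a fixed point of the contraction [x |-> y - f x]. The map expands
    distances by at least [1 - k], which gives injectivity and a Lipschitz inverse. *)
Lemma contraction_homeomorphism n (f : 'rV[R]_n -> 'rV[R]_n) (k : R) :
  0 <= k < 1 -> (forall x y, `|f x - f y| <= k * `|x - y|) ->
  homeomorphism (fun x => x + f x).
Proof.
move=> /andP[k0 k1] fk.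
have expand x y : (1 - k) * `|x - y| <= `|(x + f x) - (y + f y)|.
  have -> : (x + f x) - (y + f y) = (x - y) - (f y - f x).
    by rewrite opprB opprD addrACA.
  apply: le_trans _ (lerB_dist _ _).
  have := fk y x; rewrite (distrC y x); lra.
have surj y : exists x, x + f x = y.
  pose h x := y - f x.
  have hf : forall x, setT x -> setT (h x) by [].
  pose hF := HB.pack_for {fun [set: 'rV[R]_n] >-> [set: 'rV[R]_n]} h
    (isFun.Build _ _ _ _ h hf).
  have hcontr : is_contraction hF.
    exists (NngNum k0); split => //= -[u v] _ /=.
    by rewrite /h opprB addrC subrKA distrC fk.
  have hne : [set: 'rV[R]_n] !=set0 by exists 0.
  have [p _ hp] := banach_fixed_point hcontr closedT hne.
  by exists p; rewrite [X in X + _]hp /= /h subrK.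
have [g gP] := choice surj.
have inj x y : x + f x = y + f y -> x = y.
  move=> e; have := expand x y; rewrite e subrr normr0 => h.
  have : `|x - y| <= 0 by rewrite -(pmulr_rle0 _ (_ : 0 < 1 - k)) // subr_gt0.
  by rewrite normr_le0 subr_eq0 => /eqP.
split.
  apply: (@continuous_lipschitz _ _ _ (1 + k)) => x y.
  by rewrite opprD addrACA mulrDl mul1r (le_trans (ler_normD _ _)) // lerD.
exists g; split.
- apply: (@continuous_lipschitz _ _ _ (1 - k)^-1) => x y.
  by rewrite -ler_pdivrMl ?invr_gt0 ?subr_gt0 // invrK -{2}(gP x) -{2}(gP y).
- by move=> x; apply: inj; rewrite gP.
- exact: gP.
Qed.

(* McShane's extension, applied to each coordinate: it does not increase the
   Lipschitz constant because the norm is the sup norm. *)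
Lemma lipschitz_extension n (I : Type) (D : set I) (x d : I -> 'rV[R]_n)
    (k : R) :
  0 <= k -> D !=set0 ->
  (forall i j, D i -> D j -> `|d i - d j| <= k * `|x i - x j|) ->
  exists f : 'rV[R]_n -> 'rV[R]_n,
    (forall y z, `|f y - f z| <= k * `|y - z|) /\
    (forall i, D i -> f (x i) = d i).
Proof.
move=> k0 [i0 Di0] dk.
pose S l z := [set d i 0 l + k * `|z - x i| | i in D].
have dkl l i j : D i -> D j -> d i 0 l - d j 0 l <= k * `|x i - x j|.
  move=> Di Dj; apply: le_trans (dk _ _ Di Dj).
  apply: le_trans (ler_norm _) _.
  by have := ler_coord_norm (d i - d j) l; rewrite !mxE.
have lb l i z : D i -> lbound (S l z) (d i 0 l - k * `|z - x i|).
  move=> Di _ [j Dj <-].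
  rewrite lerBlDr -addrA -lerBlDl.
  apply: le_trans (dkl l _ _ Di Dj) _.
  rewrite -mulrDr ler_wpM2l // [leRHS]addrC (distrC z (x i)).
  exact: ler_distD.
have S0 l z : S l z !=set0 by exists (d i0 0 l + k * `|z - x i0|); exists i0.
have hlb l z : has_lbound (S l z) by eexists; apply: (lb l i0 z Di0).
exists (fun z => \row_l inf (S l z)); split.
  suff H y z l : inf (S l y) - inf (S l z) <= k * `|y - z|.
    move=> y z; apply: ler_rV_norm => [|l]; first by rewrite mulr_ge0.
    by rewrite !mxE ler_norml lerNl opprB {1}distrC !H.
  rewrite lerBlDr -lerBlDl; apply: lb_le_inf => // _ [i Di <-].
  rewrite lerBlDr; apply: (@le_trans _ _ (d i 0 l + k * `|y - x i|)).
    by apply: ge_inf => //; exists i.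
  rewrite -addrA lerD2l -mulrDr ler_wpM2l // [leRHS]addrC.
  exact: ler_distD.
move=> i Di; apply/rowP => l; rewrite mxE; apply/eqP; rewrite eq_le.
apply/andP; split.
  by apply: ge_inf => //; exists i => //; rewrite subrr normr0 mulr0 addr0.
apply: lb_le_inf => //; have := lb l i (x i) Di.
by rewrite subrr normr0 mulr0 subr0.
Qed.

(** The points are named by an index, so that the same [d] can serve for their successive positions
    when small displacements are composed. *)
Lemma isotopic_small_displacement (I : Type) (D : set I) (x d : I -> E3)
    (k : R) :
  0 <= k < 1 -> D !=set0 ->
  (forall i j, D i -> D j -> `|d i - d j| <= k * `|x i - x j|) ->
  ambient_isotopic (x @` D) ((fun i => x i + d i) @` D).
Proof.
move=> /andP[k0 k1] D0 dk.
have [f [fk fx]] := lipschitz_extension k0 D0 dk.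
exists (fun tz => tz.2 + tz.1 *: f tz.2); split.
- apply: continuous_subspaceT => z; apply: cvgD; first exact: cvg_snd.
  apply: cvgZ; first exact: cvg_fst.
  apply: (@continuous_comp _ _ _ snd f); first exact: cvg_snd.
  exact: continuous_lipschitz fk _.
- move=> t; rewrite in_itv /= => /andP[t0 t1].
  apply: (@contraction_homeomorphism _ (fun z => t *: f z) k).
    by rewrite k0.
  move=> y z; rewrite -scalerBr normrZ ger0_norm //.
  by apply: le_trans (fk y z); rewrite ler_piMl.
- by move=> z; rewrite /= scale0r addr0.
- rewrite image_comp; apply: eq_imagel => i Di /=.
  by rewrite scale1r fx.
Qed.

Lemma isotopic_displacement (I : Type) (D : set I) (x d : I -> E3) (M : R) :
  D !=set0 ->
  (forall i j t, D i -> D j -> 0 <= t <= 1 ->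
     `|d i - d j| <= M * `|(x i + t *: d i) - (x j + t *: d j)|) ->
  ambient_isotopic (x @` D) ((fun i => x i + d i) @` D).
Proof.
move=> D0 dM.
(* Each of the [N] steps displaces by [d / N]. By the hypothesis at time [m / N] this is Lipschitz
   with constant [|M| / N < 1] in terms of the current positions. *)
pose N := (Num.truncn `|M|).+1.
have N0 : (0 : R) < N%:R by rewrite ltr0n.
have MN : `|M| < N%:R by rewrite truncnS_gt.
pose X (m : nat) := (fun i => x i + (m%:R / N%:R) *: d i) @` D.
have step m : (m < N)%N -> ambient_isotopic (X m) (X m.+1).
  move=> mN.
  have -> : X m.+1 =
      (fun i => (x i + (m%:R / N%:R) *: d i) + N%:R^-1 *: d i) @` D.
    apply: eq_imagel => i _.
    by rewrite -addrA -scalerDl -[in LHS]natr1 mulrDl mul1r.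
  apply: (@isotopic_small_displacement _ _ _ _ (`|M| / N%:R)) => //.
    by rewrite divr_ge0 //= ltr_pdivrMr // mul1r.
  move=> i j Di Dj; rewrite -scalerBr normrZ gtr0_norm ?invr_gt0 //.
  rewrite mulrAC mulrC ler_pM2r ?invr_gt0 //.
  apply: le_trans (dM i j (m%:R / N%:R) Di Dj _) _.
    by rewrite divr_ge0 //= ler_pdivrMr // mul1r ler_nat ltnW.
  by rewrite ler_wpM2r // ler_norm.
have chain m : (m <= N)%N -> ambient_isotopic (X 0%N) (X m).
  elim: m => [_|m IH mN]; first exact: ambient_isotopic_refl.
  by apply: ambient_isotopic_trans (IH (ltnW mN)) (step _ mN).
have := chain N (leqnn _); rewrite /X mul0r divff ?gt_eqF //.
rewrite (@eq_imagel _ _ D (fun i => x i + 0 *: d i) x); last first.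
  by move=> i _; rewrite scale0r addr0.
rewrite (@eq_imagel _ _ D (fun i => x i + 1 *: d i) (fun i => x i + d i)) //.
by move=> i _; rewrite scale1r.
Qed.

End Isotopy.

(** * Segments and triangles *)

Ltac vec_ring := apply/rowP => ?; rewrite !mxE; ring.
Ltac vec_field := apply/rowP => ?; rewrite !mxE; field.

Section Geometry.
Variable R : realType.
Local Notation E3 := 'rV[R]_3.

Lemma continuous_bigsum (V : normedModType R) (T : topologicalType) m
    (f : 'I_m -> T -> V) :
  (forall i, continuous (f i)) -> continuous (fun x => \sum_i f i x).
Proof.
move=> cf; elim: (index_enum _) => [|i r IH].
  under eq_fun do rewrite big_nil.
  by move=> x; exact: cvg_cst.
under eq_fun do rewrite big_cons.
by move=> x; apply: cvgD; [exact: cf|exact: IH].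
Qed.

Lemma continuous_scale (V : normedModType R) (T : topologicalType)
    (f : T -> R) (v : V) :
  continuous f -> continuous (fun x => f x *: v).
Proof. by move=> cf x; apply: cvgZ; [exact: cf|exact: cvg_cst]. Qed.

(** Both sides are homogeneous in [a], so only coefficients of sum 1 matter. They form a compact
    simplex, on which the norm attains its minimum, and the hypothesis makes this minimum
    positive. *)
Lemma cone_lower_bound (V : normedModType R) m (v : 'I_m -> V) :
  (forall a : 'I_m -> R, (forall i, 0 <= a i) -> \sum_i a i *: v i = 0 ->
     forall i, a i = 0) ->
  exists2 c : R, 0 < c & forall a : 'I_m -> R, (forall i, 0 <= a i) ->
     c * \sum_i a i <= `|\sum_i a i *: v i|.
Proof.
case: m v => [v _|m v hv].
  by exists 1 => // a _; rewrite !big_ord0 mulr0.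
pose A := [set w : 'rV[R]_m.+1 | (forall i, 0 <= w 0 i) /\ \sum_i w 0 i = 1].
pose f (w : 'rV[R]_m.+1) := `|\sum_i w 0 i *: v i|.
have coordc i : continuous (fun w : 'rV[R]_m.+1 => w 0 i).
  exact: coord_continuous.
have cf : continuous f.
  move=> w; apply: (@continuous_comp _ _ _
    (fun w : 'rV[R]_m.+1 => \sum_i w 0 i *: v i) Num.norm).
    apply: continuous_bigsum => i; apply: continuous_scale; exact: coordc.
  exact: norm_continuous.
have Acompact : compact A.
  apply: bounded_closed_compact.
    exists 1; split => // M M1 w [w0 w1]; apply: ler_rV_norm => [|i].
      by rewrite ltW // (lt_trans _ M1).
    rewrite ger0_norm // (le_trans _ (ltW M1)) // -w1.
    by rewrite (bigD1 i) //= lerDl sumr_ge0.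
  have -> : A =
    (\bigcap_i ((fun w : 'rV[R]_m.+1 => w 0 i) @^-1` [set x | 0 <= x]))
     `&` ((fun w : 'rV[R]_m.+1 => \sum_i w 0 i) @^-1` [set 1]).
    by apply/seteqP; split => w [h1 h2]; split => // i *; exact: h1.
  apply: closedI.
    apply: closed_bigI => i _.
    by move/continuous_closedP: (coordc i); apply; exact: closed_ge.
  have csum : continuous (fun w : 'rV[R]_m.+1 => \sum_i w 0 i).
    by apply: (@continuous_bigsum R^o) => i; exact: coordc.
  by move/continuous_closedP: csum; apply; exact: closed_eq.
have A0 : A !=set0.
  exists (delta_mx 0 0); split => [i|]; first by rewrite mxE ler0n.
  rewrite (bigD1 0) //= big1 ?addr0 ?mxE ?eqxx // => i i0.
  by rewrite mxE (negbTE i0) andbF.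
have [w /set_mem [w0 w1] wmin] :=
  EVT_min_rV A0 Acompact (continuous_subspaceT cf).
exists (f w).
  rewrite normr_gt0; apply/eqP => /(hv (fun i => w 0 i) w0) wz.
  by move: w1; rewrite big1 // => /esym /eqP; rewrite oner_eq0.
move=> a a0; set s := \sum_i a i.
have s0 : 0 <= s by exact: sumr_ge0.
have [->|sn0] := eqVneq s 0; first by rewrite mulr0.
have sp : 0 < s by rewrite lt_neqAle eq_sym sn0.
have Aa : (\row_i (s^-1 * a i)) \in A.
  apply/mem_set; split => [i|]; first by rewrite mxE mulr_ge0 // invr_ge0.
  under eq_bigr do rewrite mxE.
  by rewrite -mulr_sumr mulVf.
rewrite -ler_pdivlMr //; apply: le_trans (wmin _ Aa) _.
rewrite /f; under eq_bigr do rewrite mxE -scalerA.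
by rewrite -scaler_sumr normrZ ger0_norm ?invr_ge0 // mulrC.
Qed.

Definition indep (u v : E3) :=
  forall a b : R, a *: u + b *: v = 0 -> a = 0 /\ b = 0.

Lemma cone_lower_bound3 (u v w : E3) :
  (forall a b c : R, 0 <= a -> 0 <= b -> 0 <= c ->
     a *: u + b *: v + c *: w = 0 -> [/\ a = 0, b = 0 & c = 0]) ->
  exists2 k : R, 0 < k & forall a b c : R, 0 <= a -> 0 <= b -> 0 <= c ->
     k * (a + b + c) <= `|a *: u + b *: v + c *: w|.
Proof.
move=> h; pose vs (i : 'I_3) : E3 := nth 0 [:: u; v; w] i.
have sumE (a : 'I_3 -> R) : \sum_i a i *: vs i =
    a 0 *: u + a 1 *: v + a 2%:R *: w.
  rewrite !big_ord_recl big_ord0 addr0 addrA.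
  by congr (_ *: _ + _ *: _ + _ *: _); congr a; apply: val_inj.
have [a a0|k k0 hk] := @cone_lower_bound _ _ vs.
  rewrite sumE => /h [] // z0 z1 z2 [[|[|[|//]]] hi].
  - by rewrite -z0; congr a; apply: val_inj.
  - by rewrite -z1; congr a; apply: val_inj.
  - by rewrite -z2; congr a; apply: val_inj.
exists k => // a b c a0 b0 c0.
pose f (i : 'I_3) := nth 0 [:: a; b; c] i.
have := hk f; rewrite sumE !big_ord_recl big_ord0 addr0 addrA; apply.
by case=> [[|[|[|//]]] hi].
Qed.

(** Changing the sign of [v], or of both coefficients, reduces arbitrary coefficients to the cones
    spanned by [u] with [v] and by [u] with [- v]. *)
Lemma indep_lower_bound (u v : E3) : indep u v ->
  exists2 k : R, 0 < k & forall a b, k * `|a| <= `|a *: u + b *: v|.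
Proof.
move=> uv.
have H (w : E3) : indep u w ->
    exists2 k : R, 0 < k & forall a b, 0 <= a -> 0 <= b ->
      k * a <= `|a *: u + b *: w|.
  move=> uw; pose vs (i : 'I_2) : E3 := nth 0 [:: u; w] i.
  have [a a0|k k0 hk] := @cone_lower_bound _ _ vs.
    rewrite !big_ord_recl big_ord0 addr0 => /uw [z0 z1] [[|[|//]] hi].
    - by rewrite -z0; congr a; apply: val_inj.
    - by rewrite -z1; congr a; apply: val_inj.
  exists k => // a b a0 b0.
  have := hk (fun i : 'I_2 => nth 0 [:: a; b] i).
  rewrite !big_ord_recl !big_ord0 !addr0 /= => hab.
  apply: le_trans (hab _); last by case=> [[|[|//]] hi].
  by rewrite ler_wpM2l ?lerDl // ltW.
have [k1 k10 h1] := H v uv.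
have [|k2 k20 h2] := H (- v).
  move=> a b; rewrite scalerN -scaleNr => /uv [-> /eqP].
  by rewrite oppr_eq0 => /eqP.
exists (Num.min k1 k2); first by rewrite lt_min k10.
have H2 a b : 0 <= a -> Num.min k1 k2 * a <= `|a *: u + b *: v|.
  move=> a0; have [b0|b0] := leP 0 b.
    apply: le_trans (h1 _ _ a0 b0); apply: ler_wpM2r => //.
    by rewrite ge_min lexx.
  have nb : 0 <= - b by rewrite oppr_ge0 ltW.
  have := h2 _ _ a0 nb; rewrite scalerN -scaleNr opprK; apply: le_trans.
  apply: ler_wpM2r => //.
  by rewrite ge_min lexx orbT.
move=> a b; have [a0|a0] := leP 0 a.
  by rewrite ger0_norm // H2.
by rewrite (ltr0_norm a0) -normrN opprD -!scaleNr H2 // oppr_ge0 ltW.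
Qed.

Lemma compact_disjoint_dist (V : normedModType R) (A B : set V) :
  compact A -> compact B -> A `&` B = set0 ->
  exists2 k : R, 0 < k & forall x y, A x -> B y -> k <= `|x - y|.
Proof.
move=> cA cB AB.
have [AB0|/set0P AB0] := eqVneq (A `*` B) set0.
  by exists 1 => // x y Ax By; have : (A `*` B) (x, y) by []; rewrite AB0.
pose f (xy : V * V) := `|xy.1 - xy.2|.
have cf : continuous f.
  move=> z; apply: (@continuous_comp _ _ _ (fun xy : V * V => xy.1 - xy.2)
    Num.norm).
    by apply: cvgB; [exact: cvg_fst|exact: cvg_snd].
  exact: norm_continuous.
have [[a b] /set_mem [/= Aa Bb] min] :=
  compact_EVT_min AB0 (compact_setX cA cB) (continuous_subspaceT cf).
exists (f (a, b)).
  rewrite normr_gt0 /= subr_eq0; apply/eqP => ab.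
  have : (A `&` B) a by split; rewrite // ab.
  by rewrite AB.
by move=> x y Ax By; apply: (min (x, y)); apply/mem_set.
Qed.

Definition seg (p q : E3) : set E3 :=
  [set x | exists2 s : R, 0 <= s <= 1 & x = p + s *: (q - p)].

Definition tri (a b c : E3) : set E3 :=
  [set x | exists s t : R,
     [/\ 0 <= s, 0 <= t, s + t <= 1 & x = a + s *: (b - a) + t *: (c - a)]].

Lemma seg_sym p q : seg p q = seg q p.
Proof.
have H p' q' x : seg p' q' x -> seg q' p' x.
  by move=> [s s01 ->]; exists (1 - s); [lra|vec_ring].
by apply/seteqP; split => x; exact: H.
Qed.

Lemma segl p q : seg p q p.
Proof. by exists 0; [rewrite lexx ler01|vec_ring]. Qed.

Lemma segr p q : seg p q q.
Proof. by rewrite seg_sym; exact: segl. Qed.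

Lemma tri_swap a b c : tri a b c = tri b a c.
Proof.
have H a' b' x : tri a' b' c x -> tri b' a' c x.
  move=> [s [t [s0 t0 st ->]]]; exists (1 - s - t), t.
  by split => //; [lra|lra|vec_ring].
by apply/seteqP; split => x; exact: H.
Qed.

Lemma seg_sub_tri a b c : seg a b `<=` tri a b c.
Proof.
by move=> x [s /andP[s0 s1] ->]; exists s, 0;
  rewrite addr0; split => //; vec_ring.
Qed.

Lemma leg_sub_tri a b c : seg a c `<=` tri a b c.
Proof.
by move=> x [s /andP[s0 s1] ->]; exists 0, s;
  rewrite add0r; split => //; vec_ring.
Qed.

Lemma compact_seg p q : compact (seg p q).
Proof.
have -> : seg p q = (fun s : R => p + s *: (q - p)) @` `[0, 1].
  by apply/seteqP; split => x [s h1 h2]; exists s;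
    rewrite ?h2 //= ?in_itv //= in h1 *.
apply: continuous_compact; last exact: segment_compact.
apply: continuous_subspaceT => s; apply: cvgD; first exact: cvg_cst.
by apply: continuous_scale => ?; exact: cvg_id.
Qed.

Lemma compact_tri a b c : compact (tri a b c).
Proof.
(* The square is collapsed onto the triangle: [st.1] is the total weight away from [a], and [st.2]
   is the share of it that [c] receives. At [a] itself the share is arbitrary, hence the case
   distinction below. *)
pose f (st : R * R) : E3 :=
  a + (st.1 * (1 - st.2)) *: (b - a) + (st.1 * st.2) *: (c - a).
have -> : tri a b c = f @` (`[0, 1] `*` `[0, 1]).
  apply/seteqP; split => x.
    move=> [s [t [s0 t0 st ->]]].
    have [st0|st0] := eqVneq (s + t) 0.
      have [-> ->] : s = 0 /\ t = 0 by split; lra.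
      exists (0, 0); last by rewrite /f /=; vec_ring.
      by split; rewrite /= in_itv /= lexx ler01.
    have st0' : 0 < s + t by rewrite lt_neqAle eq_sym st0 addr_ge0.
    exists (s + t, t / (s + t)); last by rewrite /f /=; vec_field.
    split; rewrite /= in_itv /=; first by rewrite ltW.
    by rewrite divr_ge0 ?addr_ge0 //= ler_pdivrMr // mul1r lerDr.
  move=> [[s t] [/=]]; rewrite !in_itv /= => /andP[s0 s1] /andP[t0 t1] <-.
  exists (s * (1 - t)), (s * t); split => //.
  - by rewrite mulr_ge0 // subr_ge0.
  - by rewrite mulr_ge0.
  - by rewrite -mulrDr subrK mulr1.
apply: continuous_compact; last by apply: compact_setX; exact: segment_compact.
have c1 : continuous (fun st : R * R => st.1) by move=> ?; exact: cvg_fst.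
have c2 : continuous (fun st : R * R => st.2) by move=> ?; exact: cvg_snd.
apply: continuous_subspaceT => z; apply: cvgD; first apply: cvgD.
- exact: cvg_cst.
- apply: cvgZ; last exact: cvg_cst.
  apply: cvgM; first exact: c1.
  by apply: cvgB; [exact: cvg_cst|exact: c2].
- apply: cvgZ; last exact: cvg_cst.
  by apply: cvgM; [exact: c1|exact: c2].
Qed.

End Geometry.

(** * Linear complexes *)

Section Complexes.
Variable R : realType.
Local Notation E3 := 'rV[R]_3.
Local Notation edge := (E3 * E3)%type.

(** * Distance between a triangle and a segment *)

Lemma indep_neq0 (u v : E3) : indep u v -> u != 0.
Proof.
move=> uv; apply/eqP => u0; have [] := uv 1 0.
  by rewrite u0 scaler0 scale0r addr0.
by move/eqP; rewrite oner_eq0.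
Qed.

Lemma tri_indep_swap (a b c : E3) :
  indep (b - a) (c - a) -> indep (a - b) (c - b).
Proof.
move=> h s t st; have [] := h (- s - t) t.
  by rewrite -[RHS]st; vec_ring.
by move=> h1 h2; split; lra.
Qed.

(** The difference of the two points is a non-negative combination of [b - a], [c - a] and [a - q],
    and [1 - r = s + t] is part of its coefficient sum; so the bound on cones applies once these
    vectors admit no non-trivial relation with non-negative coefficients. *)
Lemma tri_seg_bound_vertex (a b c q : E3) :
  indep (b - a) (c - a) -> a != q ->
  (forall x, tri a b c x -> seg a q x -> x = a) ->
  exists2 k : R, 0 < k & forall r s t y, 0 <= r -> 0 <= s -> 0 <= t ->
    r + s + t = 1 -> seg a q y ->
    k * (1 - r) <= `|(r *: a + s *: b + t *: c) - y|.
Proof.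
move=> abc aq h.
have [al be ga al0 be0 ga0 e|k k0 hk] :=
    @cone_lower_bound3 R (b - a) (c - a) (a - q).
  have [ga00|gan] := eqVneq ga 0.
    move: e; rewrite ga00 scale0r addr0 => /abc [-> ->]; by split.
  have gap : 0 < ga by rewrite lt_neqAle eq_sym gan.
  set M := al + be + ga.
  have M0 : 0 < M by rewrite ltr_wpDl // addr_ge0.
  (* Divided by [M], such a relation exhibits [x] as a point of the triangle as well as of the
     segment; but [ga > 0] makes it different from [a]. *)
  pose x := a + (ga / M) *: (q - a).
  have : x = a.
    apply: h.
      exists (al / M), (be / M); split.
      - by rewrite divr_ge0 // ltW.
      - by rewrite divr_ge0 // ltW.
      - by rewrite -mulrDl ler_pdivrMr // mul1r /M lerDl.
      - apply/eqP; rewrite -subr_eq0 -oppr_eq0 opprB.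
        have -> : a + (al / M) *: (b - a) + (be / M) *: (c - a) - x =
          M^-1 *: (al *: (b - a) + be *: (c - a) + ga *: (a - q)).
          by rewrite /x; vec_ring.
        by rewrite e scaler0.
    exists (ga / M) => //.
    by rewrite divr_ge0 ?(ltW M0) //= ler_pdivrMr // mul1r /M; lra.
  move=> /eqP; rewrite /x -subr_eq0 addrAC subrr add0r scaler_eq0.
  rewrite (subr_eq0 q) (eq_sym q) (negbTE aq) orbF mulf_eq0 (negbTE gan) /=.
  by rewrite invr_eq0 gt_eqF.
exists k => // r s t y r0 s0 t0 rst [g /andP[g0 g1] ->].
have -> : r *: a + s *: b + t *: c - (a + g *: (q - a)) =
    s *: (b - a) + t *: (c - a) + g *: (a - q).
  have -> : r = 1 - s - t by lra.
  by vec_ring.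
by apply: le_trans (hk _ _ _ s0 t0 g0); rewrite ler_pM2l //; lra.
Qed.

(** The factor [Num.min (1 - r) (1 - s)] vanishes exactly at the base vertices, where contact is
    allowed. The segment cannot contain both of them, because the midpoint of the base would then be
    a forbidden common point. If it contains one, that vertex is an endpoint of it and the previous
    bound applies; if it contains none, the two sets are disjoint and compact. *)
Lemma tri_seg_bound (a b c p q : E3) :
  indep (b - a) (c - a) -> p != q ->
  (forall x, tri a b c x -> seg p q x ->
     (x = a \/ x = b) /\ (x = p \/ x = q)) ->
  exists2 k : R, 0 < k & forall r s t y, 0 <= r -> 0 <= s -> 0 <= t ->
    r + s + t = 1 -> seg p q y ->
    k * Num.min (1 - r) (1 - s) <= `|(r *: a + s *: b + t *: c) - y|.
Proof.
move=> abc pq h.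
have ab : a != b by rewrite eq_sym -subr_eq0; exact: indep_neq0 abc.
have nboth : seg p q a -> ~ seg p q b.
  move=> [s /andP[s0 s1] es] [t /andP[t0 t1] et].
  pose m := 2^-1 *: a + 2^-1 *: b.
  have [||+ _] := h m.
  - by apply: seg_sub_tri; exists 2^-1; [lra|rewrite /m; vec_field].
  - by exists ((s + t) / 2); [lra|rewrite /m es et; vec_field].
  have e2 (x y : E3) : 2^-1 *: x + 2^-1 *: y = x -> x = y.
    move=> e; have -> : y = 2 *: (2^-1 *: x + 2^-1 *: y) - x by vec_field.
    by rewrite e; vec_ring.
  case=> e; move/eqP: ab; apply; first exact: e2 e.
  by apply/esym/e2; rewrite addrC.
have min_le (k u v z : R) : 0 < k -> k * u <= z \/ k * v <= z ->
    k * Num.min u v <= z.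
  move=> k0; case; apply: le_trans; rewrite ler_pM2l // ge_min lexx //.
  by rewrite orbT.
have vertex a' b' : indep (b' - a') (c - a') ->
    (forall x, tri a' b' c x -> seg p q x -> x = a' /\ (x = p \/ x = q)) ->
    seg p q a' ->
    exists2 k : R, 0 < k & forall r s t y, 0 <= r -> 0 <= s -> 0 <= t ->
      r + s + t = 1 -> seg p q y ->
      k * (1 - r) <= `|(r *: a' + s *: b' + t *: c) - y|.
  move=> abc' h' sa.
  have ta : tri a' b' c a' by apply: seg_sub_tri; exact: segl.
  have [_ [e|e]] := h' a' ta sa; move: pq h' sa; rewrite -e => pq' h' sa.
    by apply: tri_seg_bound_vertex => // x xt xs; have [] := h' _ xt xs.
  rewrite seg_sym; apply: tri_seg_bound_vertex => //; first by rewrite eq_sym.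
  by move=> x xt; rewrite seg_sym => xs; have [] := h' x xt xs.
have [sa|nsa] := pselect (seg p q a).
  have hv x : tri a b c x -> seg p q x -> x = a /\ (x = p \/ x = q).
    move=> xt xs; have [[//|xb] ?] := h x xt xs.
    by case: (nboth sa); rewrite -xb.
  have [k k0 hk] := vertex a b abc hv sa.
  exists k => // r s t y r0 s0 t0 rst ys.
  by apply: min_le => //; left; exact: hk.
have [sb|nsb] := pselect (seg p q b).
  have hv x : tri b a c x -> seg p q x -> x = b /\ (x = p \/ x = q).
    rewrite tri_swap => xt xs; have [[xa|//] ?] := h x xt xs.
    by case: nsa; rewrite -xa.
  have [k k0 hk] := vertex b a (tri_indep_swap abc) hv sb.
  exists k => // r s t y r0 s0 t0 rst ys.
  apply: min_le => //; right; rewrite (addrC (r *: a)); apply: hk => //.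
  by rewrite (addrC s).
have [|k k0 hk] :=
    compact_disjoint_dist (@compact_tri R a b c) (@compact_seg R p q).
  apply/seteqP; split => // x [xt xs].
  have [[e|e] _] := h x xt xs; first by apply: nsa; rewrite -e.
  by apply: nsb; rewrite -e.
exists k => // r s t y r0 s0 t0 rst ys.
apply: (@le_trans _ _ k).
  by rewrite -[leRHS]mulr1 ler_pM2l // ge_min; apply/orP; left; lra.
apply: hk => //; exists s, t; split => //; first lra.
by have -> : r = 1 - s - t; [lra|vec_ring].
Qed.

(** * Edge sets with controlled intersections *)

Definition body (L : seq edge) : set E3 :=
  [set x | exists2 S, S \in L & seg S.1 S.2 x].

Definition touches (x : E3) (S : edge) : bool := (x == S.1) || (x == S.2).

Definition meet_ok (S T : edge) : Prop :=
  forall x, seg S.1 S.2 x -> seg T.1 T.2 x -> touches x S /\ touches x T.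

Definition proper (L : seq edge) : Prop :=
  [/\ uniq L, {in L, forall S, S.1 != S.2} &
      {in L &, forall S T, S != T -> meet_ok S T}].

(** Neither a cyclic order of the edges nor connectedness is recorded: the moves are local, and the
    final set is a simple closed curve because it is isotopic to one. The bound on degrees serves to
    choose the side of the teeth at an endpoint. *)
Definition complex (L : seq edge) : Prop :=
  proper L /\ forall x, (count (touches x) L <= 2)%N.

Lemma meet_ok_sym S T : meet_ok S T -> meet_ok T S.
Proof. by move=> h x xT xS; have [] := h x xS xT. Qed.

(** The midpoint of a non-degenerate edge is not one of its endpoints. *)
Lemma meet_ok_neq S T : S.1 != S.2 -> meet_ok S T -> S != T.
Proof.
move=> S12 h; apply/eqP => ST; rewrite -ST in h.
pose m := 2^-1 *: S.1 + 2^-1 *: S.2.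
have sm : seg S.1 S.2 m by exists 2^-1; [lra|rewrite /m; vec_field].
have e2 (x y : E3) : 2^-1 *: x + 2^-1 *: y = x -> x = y.
  move=> e; have -> : y = 2 *: (2^-1 *: x + 2^-1 *: y) - x by vec_field.
  by rewrite e; vec_ring.
have [/orP[/eqP e|/eqP e] _] := h m sm sm; move/eqP: S12; apply.
  exact: e2 e.
by apply/esym/e2; rewrite addrC.
Qed.

Lemma proper_cons S A :
  proper (S :: A) <->
  [/\ S.1 != S.2, {in A, forall T, meet_ok S T} & proper A].
Proof.
split=> [[/= /andP[SA uA] nd mt]|[S12 mS [uA nd mt]]].
  split; first by apply: nd; rewrite mem_head.
    move=> T TA; apply: mt; rewrite ?mem_head ?inE ?TA ?orbT //.
    by apply: contraNneq SA => ->.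
  split => // [T TA|T U TA UA]; first by apply: nd; rewrite inE TA orbT.
  by apply: mt; rewrite inE ?TA ?UA orbT.
split => /=.
- rewrite uA andbT; apply/negP => SA.
  by have := meet_ok_neq S12 (mS _ SA); rewrite eqxx.
- by move=> T; rewrite inE => /predU1P[->//|]; exact: nd.
- move=> T U; rewrite !inE => /predU1P[->|TA] /predU1P[->|UA].
  + by rewrite eqxx.
  + by move=> _; exact: mS.
  + by move=> _; apply: meet_ok_sym; exact: mS.
  + exact: mt.
Qed.

Lemma complex_perm L L' : perm_eq L L' -> complex L -> complex L'.
Proof.
move=> LL' [[uL nd mt] deg]; have mem := perm_mem LL'.
split; last by move=> x; rewrite -(permP LL').
split; first by rewrite -(perm_uniq LL').
  by move=> S; rewrite -mem; exact: nd.
by move=> S T; rewrite -!mem; exact: mt.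
Qed.

Lemma body_perm L L' : perm_eq L L' -> body L = body L'.
Proof.
move=> LL'; have mem := perm_mem LL'.
by apply/seteqP; split => x [S SL xS]; exists S; rewrite // ?mem // -mem.
Qed.

Lemma body_cons S A : body (S :: A) = seg S.1 S.2 `|` body A.
Proof.
apply/seteqP; split => x.
  by move=> [T]; rewrite inE => /predU1P[->|TA] xT; [left|right; exists T].
move=> [xS|[T TA xT]]; first by exists S; rewrite ?mem_head.
by exists T; rewrite // inE TA orbT.
Qed.

(** Common core of subdivision and of the move across a triangle. The degrees of [a] and [b] are
    unchanged; [c] gets degree 2, since an edge of [A] through [c] would force [c] to be [a] or
    [b]. *)
Lemma complex_replace (a b c : E3) A :
  complex ((a, b) :: A) -> c != a -> c != b ->
  {in A, forall S x, seg a c x \/ seg c b x -> seg S.1 S.2 x ->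
     x = a \/ x = b} ->
  ~ seg a c b -> ~ seg c b a -> (forall x, seg a c x -> seg c b x -> x = c) ->
  complex ((a, c) :: (c, b) :: A).
Proof.
move=> [/proper_cons [/= ab mab pA] deg] ca cb hA nb na hc.
have touch S x : S \in A -> seg a b x -> seg S.1 S.2 x -> touches x S.
  by move=> SA xab xS; have [] := mab _ SA x xab xS.
split.
  apply/proper_cons; split => /=; first by rewrite eq_sym.
    move=> T; rewrite inE => /predU1P[->|TA] x /= xac xT.
      by rewrite /touches /= (hc x xac xT) !eqxx orbT.
    have [xa|xb] := hA _ TA x (or_introl xac) xT; last first.
      by case: nb; rewrite -xb.
    split; first by rewrite /touches /= xa eqxx.
    by apply: touch => //; rewrite xa; exact: segl.
  apply/proper_cons; split => //= T TA x /= xcb xT.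
  have [xa|xb] := hA _ TA x (or_intror xcb) xT.
    by case: na; rewrite -xa.
  split; first by rewrite /touches /= xb eqxx orbT.
  by apply: touch => //; rewrite xb; exact: segr.
move=> x; have := deg x; rewrite /= /touches /=.
have [xc _|xc] := eqVneq x c.
  suff -> : count (fun S : edge => (x == S.1) || (x == S.2)) A = 0%N.
    by rewrite addn0; case: (_ || _); case: (_ || _).
  apply/eqP; rewrite -leqn0 leqNgt -has_count; apply/hasPn => T TA.
  apply/negP => xT.
  have xT' : seg T.1 T.2 x.
    by case/orP: xT => /eqP ->; [exact: segl|exact: segr].
  have [|e|e] := hA T TA x _ xT'.
  - by left; rewrite xc; exact: segr.
  - by move/eqP: ca; apply; rewrite -xc.
  - by move/eqP: cb; apply; rewrite -xc.
rewrite orbF /= addnA; apply: leq_trans; rewrite leq_add2r.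
have [xa|//] := eqVneq x a.
by rewrite xa (negbTE ab).
Qed.

Lemma complex_subdivide (a b : E3) (s : R) A :
  complex ((a, b) :: A) -> 0 < s < 1 ->
  let m := a + s *: (b - a) in
  complex ((a, m) :: (m, b) :: A) /\
  body ((a, m) :: (m, b) :: A) = body ((a, b) :: A).
Proof.
move=> cL /andP[s0 s1] m.
have [[/proper_cons [/= ab mab _] _] _] := (cL, tt).
have ba0 : b - a != 0 by rewrite subr_eq0 eq_sym.
have inj (t : R) : t *: (b - a) = 0 -> t = 0.
  by move=> /eqP; rewrite scaler_eq0 (negbTE ba0) orbF => /eqP.
have sam x : seg a m x -> exists2 t, 0 <= t <= s & x = a + t *: (b - a).
  move=> [t /andP[t0 t1] ->]; exists (t * s); last by rewrite /m; vec_ring.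
  by rewrite mulr_ge0 ?(ltW s0) //= ler_piMl // ltW.
have smb x : seg m b x -> exists2 t, s <= t <= 1 & x = a + t *: (b - a).
  move=> [t /andP[t0 t1] ->]; exists (s + t * (1 - s)).
    by apply/andP; split; nra.
  by rewrite /m; vec_ring.
have ma : m != a.
  apply/eqP => e; have : s = 0; last lra.
  apply: inj; have -> : s *: (b - a) = m - a by rewrite /m; vec_ring.
  by rewrite e subrr.
have mb : m != b.
  apply/eqP => e; have : 1 - s = 0; last lra.
  apply: inj; have -> : (1 - s) *: (b - a) = b - m by rewrite /m; vec_ring.
  by rewrite e subrr.
split.
  apply: complex_replace => //.
  - move=> S SA x xm xS.
    have xab : seg a b x.
      case: xm => [/sam|/smb] [t /andP[t0 t1] e]; exists t => //.
        by rewrite t0 (le_trans t1) // ltW.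
      by rewrite t1 (le_trans _ t0) // ltW.
    have [/orP[] /eqP -> _] := mab S SA x xab xS; [by left|by right].
  - move=> /sam [t /andP[t0 t1] e]; have : 1 - t = 0; last lra.
    apply: inj; have -> : (1 - t) *: (b - a) = b - (a + t *: (b - a)).
      by vec_ring.
    by rewrite -e subrr.
  - move=> /smb [t /andP[t0 t1] e]; have : t = 0; last lra.
    apply: inj; have -> : t *: (b - a) = (a + t *: (b - a)) - a by vec_ring.
    by rewrite -e subrr.
  - move=> x /sam [t /andP[t0 t1] e] /smb [t' /andP[t0' t1'] e'].
    have : t - t' = 0.
      apply: inj; have -> : (t - t') *: (b - a) =
        (a + t *: (b - a)) - (a + t' *: (b - a)) by vec_ring.
      by rewrite -e -e' subrr.
    move=> tt'; have -> : m = a + t *: (b - a); last exact: e.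
    by rewrite /m; congr (_ + _ *: _); lra.
rewrite !body_cons setUA; congr (_ `|` _); apply/seteqP; split => x.
  case=> [/sam|/smb] [t /andP[t0 t1] e]; exists t => //.
    by rewrite t0 (le_trans t1) // ltW.
  by rewrite t1 (le_trans _ t0) // ltW.
move=> [t /andP[t0 t1] ->]; have [ts|ts] := leP t s.
  left; exists (t / s); last by rewrite /m; vec_field; rewrite gt_eqF.
  by rewrite divr_ge0 ?(ltW s0) //= ler_pdivrMr // mul1r.
right; exists ((t - s) / (1 - s)).
  rewrite divr_ge0 ?subr_ge0 ?(ltW ts) ?(ltW s1) //=.
  by rewrite ler_pdivrMr ?subr_gt0 // mul1r lerB.
by rewrite /m; vec_field; rewrite subr_eq0 eq_sym lt_eqF.
Qed.

End Complexes.

(** * Moving an edge across a triangle *)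

Section Delta.
Variable R : realType.
Local Notation E3 := 'rV[R]_3.
Local Notation edge := (E3 * E3)%type.

Lemma common_positive_bound (T : eqType) (P : T -> R -> Prop) (s : seq T) :
  (forall x k k', 0 < k' <= k -> P x k -> P x k') ->
  {in s, forall x, exists2 k, 0 < k & P x k} ->
  exists2 k, 0 < k & {in s, forall x, P x k}.
Proof.
move=> mono; elim: s => [_|x s IH h]; first by exists 1.
have [|k k0 hk] := IH; first by move=> y ys; apply: h; rewrite inE ys orbT.
have [k' k'0 hk'] := h x (mem_head _ _).
have m0 : 0 < Num.min k k' by rewrite lt_min k0.
exists (Num.min k k') => // y; rewrite inE => /predU1P[->|ys].
  by apply: mono hk'; rewrite m0 ge_min lexx orbT.
by apply: mono (hk y ys); rewrite m0 ge_min lexx.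
Qed.

(** Over the base, parametrised from its midpoint [m] with half-vector [u], the two legs are the
    graph of the hat function [1 - |s|] in direction [p - m]. *)
Lemma tent_image (a b p : E3) :
  let m := 2^-1 *: (a + b) in let u := 2^-1 *: (b - a) in
  (fun s : R => m + s *: u + (1 - `|s|) *: (p - m)) @` `[-1, 1] =
  seg a p `|` seg p b.
Proof.
move=> m u; apply/seteqP; split => x.
  move=> [s]; rewrite /= in_itv /= => /andP[s0 s1] <-.
  have [sp|sn] := leP 0 s.
    right; exists s; first by rewrite sp.
    by rewrite ger0_norm // /m /u; vec_field.
  left; exists (1 + s); first by lra.
  by rewrite ltr0_norm // /m /u; vec_field.
move=> [] [s /andP[s0 s1] ->].
  exists (s - 1); first by rewrite /= in_itv /=; lra.
  by rewrite ler0_norm ?subr_le0 // /m /u; vec_field.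
exists s; first by rewrite /= in_itv /=; lra.
by rewrite ger0_norm // /m /u; vec_field.
Qed.

(** The base rises along the hat function while [B] stays fixed. Two points of the base are
    controlled by the independence of [u] and [v]; a point of the base and one of [B] are controlled
    by the hypothesis, because their distance and the displacement are both measured by
    [1 - |s|]. *)
Lemma isotopic_tent (a b c : E3) (B : set E3) (k : R) :
  indep (b - a) (c - a) -> 0 < k ->
  (forall r s t y, 0 <= r -> 0 <= s -> 0 <= t -> r + s + t = 1 -> B y ->
    k * Num.min (1 - r) (1 - s) <= `|(r *: a + s *: b + t *: c) - y|) ->
  ambient_isotopic (seg a b `|` B) (seg a c `|` seg c b `|` B).
Proof.
move=> abc k0 hk.
pose m := 2^-1 *: (a + b); pose u := 2^-1 *: (b - a); pose v := c - m.
(* The left summand names the fixed points of [B], the right one the parameters of the moving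
   base. *)
pose x (i : E3 + R) := match i with inl y => y | inr s => m + s *: u end.
pose d (i : E3 + R) : E3 :=
  match i with inl _ => 0 | inr s => (1 - `|s|) *: v end.
pose D := [set i : E3 + R |
  match i with inl y => B y | inr s => s \in `[-1, 1] end].
have split_image (f : E3 + R -> E3) :
    f @` D = (fun s => f (inr s)) @` `[-1, 1] `|` (fun y => f (inl y)) @` B.
  apply/seteqP; split => z.
    by move=> [[y|s] Di <-]; [right; exists y|left; exists s].
  by move=> [[s sI <-]|[y By <-]]; [exists (inr s)|exists (inl y)].
have -> : seg a b `|` B = x @` D.
  rewrite split_image /= image_id; congr (_ `|` _).
  transitivity (seg a m `|` seg m b).
    apply/seteqP; split => y.
      move=> [s /andP[s0 s1] ->]; have [s2|s2] := leP s 2^-1.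
        left; exists (2 * s); first by lra.
        by rewrite /m; vec_field.
      right; exists (2 * s - 1); first by lra.
      by rewrite /m; vec_field.
    move=> [] [s /andP[s0 s1] ->].
      by exists (s / 2); [lra|rewrite /m; vec_field].
    by exists ((1 + s) / 2); [lra|rewrite /m; vec_field].
  rewrite -(tent_image a b m) -/m -/u; apply: eq_imagel => s _.
  by rewrite subrr scaler0 addr0.
have -> : seg a c `|` seg c b `|` B = (fun i => x i + d i) @` D.
  rewrite split_image /= -(tent_image a b c) -/m -/u -/v.
  congr (_ `|` _); rewrite -[LHS]image_id; apply: eq_imagel => y _.
  by rewrite addr0.
have uv : indep u v.
  move=> s t st; have [] := abc (2^-1 * s - 2^-1 * t) t.
    by rewrite -[RHS]st /u /v /m; vec_field.
  by move=> h1 h2; split; lra.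
have [k' k'0 hk'] := indep_lower_bound uv.
have v0 : 0 <= `|v| by [].
(* At time [t] the weights of the moving point at [a] and at [b] are both at most
   [1 - (1 - |s|) / 2]; this is the source of the factor 2. *)
have bound y s t : B y -> s \in `[-1, 1] -> 0 <= t <= 1 ->
    k * (1 - `|s|) <= 2 * `|m + s *: u + (t * (1 - `|s|)) *: v - y|.
  rewrite in_itv /= => By /andP[s0 s1] /andP[t0 t1].
  have ns : `|s| <= 1 by rewrite ler_norml s0.
  set be := t * (1 - `|s|).
  have be0 : 0 <= be by rewrite mulr_ge0 // subr_ge0.
  have be1 : be <= 1 - `|s| by rewrite ler_piMl // subr_ge0.
  have sn := ler_norm s; have sn' := ler_norm (- s); rewrite normrN in sn'.
  have -> : m + s *: u + be *: v - y = ((1 - s - be) / 2) *: a +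
      ((1 + s - be) / 2) *: b + be *: c - y.
    by rewrite /m /u /v /m; vec_field.
  have h : k * Num.min (1 - (1 - s - be) / 2) (1 - (1 + s - be) / 2) <=
      `|((1 - s - be) / 2) *: a + ((1 + s - be) / 2) *: b + be *: c - y|.
    by apply: hk => //; lra.
  have h2 : (1 - `|s|) / 2 <=
      Num.min (1 - (1 - s - be) / 2) (1 - (1 + s - be) / 2).
    by rewrite le_min; apply/andP; split; lra.
  rewrite -(ler_pM2l k0) in h2; lra.
(* The first summand serves a pair of a moving and a fixed point, the second a pair of moving
   points. *)
pose M := `|v| * (2 / k + k'^-1).
have M1 : `|v| * (2 / k) <= M by rewrite ler_wpM2l // lerDl invr_ge0 ltW.
have M2 : `|v| * k'^-1 <= M.
  by rewrite ler_wpM2l // lerDr divr_ge0 // ltW.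
have M0 : 0 <= M by rewrite mulr_ge0 // addr_ge0 // ?divr_ge0 ?invr_ge0 // ltW.
have mixed y s t : B y -> s \in `[-1, 1] -> 0 <= t <= 1 ->
    `|d (inr s)| <= M * `|x (inr s) + t *: d (inr s) - y|.
  move=> By sI tI; rewrite /= (scalerA t).
  have := bound y s t By sI tI.
  have s1 : 0 <= 1 - `|s|.
    by move: sI; rewrite in_itv /= subr_ge0 ler_norml.
  rewrite normrZ ger0_norm // => h.
  apply: (@le_trans _ _ (`|v| * (2 / k) *
      `|m + s *: u + (t * (1 - `|s|)) *: v - y|)); last first.
    by rewrite ler_wpM2r.
  by rewrite mulrC -mulrA ler_wpM2l // mulrAC ler_pdivlMr // mulrC.
apply: (@isotopic_displacement _ _ D x d M).
  by exists (inr 0); rewrite /D /= in_itv /= lerN10 ler01.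
move=> [y|s] [z|s'] t Di Dj tI.
- by rewrite /= subrr normr0 mulr_ge0.
- rewrite [d (inl _)]/= sub0r normrN distrC /= scaler0 addr0.
  exact: mixed.
- by rewrite [d (inl _)]/= subr0 /= scaler0 addr0; exact: mixed.
- have -> : d (inr s) - d (inr s') = (`|s'| - `|s|) *: v.
    by rewrite /=; vec_ring.
  have -> : x (inr s) + t *: d (inr s) - (x (inr s') + t *: d (inr s')) =
      (s - s') *: u + (t * (`|s'| - `|s|)) *: v.
    by rewrite /=; vec_ring.
  rewrite normrZ mulrC.
  apply: (@le_trans _ _ (`|v| * k'^-1 *
    `|(s - s') *: u + (t * (`|s'| - `|s|)) *: v|)); last by rewrite ler_wpM2r.
  rewrite -mulrA ler_wpM2l // ler_pdivlMl //.
  apply: le_trans (hk' _ _); rewrite ler_pM2l //.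
  by rewrite distrC; exact: ler_dist_dist.
Qed.

(** The elementary triangle move on polygons. Each edge of [A] gives a distance bound, and the least
    of these finitely many constants works for all of [A]. *)
Lemma complex_delta (a b c : E3) A :
  complex ((a, b) :: A) -> indep (b - a) (c - a) ->
  {in A, forall S x, tri a b c x -> seg S.1 S.2 x -> x = a \/ x = b} ->
  complex ((a, c) :: (c, b) :: A) /\
  ambient_isotopic (body ((a, b) :: A)) (body ((a, c) :: (c, b) :: A)).
Proof.
move=> cL abc hA.
have [[/proper_cons [/= ab mab [_ nd _]] _] _] := (cL, tt).
have legb : seg c b `<=` tri a b c.
  by rewrite tri_swap seg_sym; exact: leg_sub_tri.
have meet S x : S \in A -> tri a b c x -> seg S.1 S.2 x ->
    (x = a \/ x = b) /\ (x = S.1 \/ x = S.2).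
  move=> SA xt xS; have xab := hA S SA x xt xS; split => //.
  have xs : seg a b x by case: xab => ->; [exact: segl|exact: segr].
  by have [_ /orP[] /eqP ->] := mab S SA x xs xS; [left|right].
split.
  apply: complex_replace => //.
  - by rewrite -subr_eq0; apply: (@indep_neq0 _ _ (b - a)) => s t;
      rewrite addrC => /abc [-> ->].
  - by rewrite -subr_eq0; apply: (@indep_neq0 _ _ (a - b)) => s t;
      rewrite addrC => /(tri_indep_swap abc) [-> ->].
  - move=> S SA x [xl|xl] xS; apply: (hA S) => //; last exact: legb.
    exact: leg_sub_tri.
  - move=> [s _ e]; have [] := abc (-1) s.
      have -> : -1 *: (b - a) + s *: (c - a) = (a + s *: (c - a)) - b.
        by vec_ring.
      by rewrite -e subrr.
    by move=> /eqP; rewrite oppr_eq0 oner_eq0.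
  - have abc' : indep (a - b) (c - b) := tri_indep_swap abc.
    rewrite seg_sym => -[s _ e]; have [] := abc' (-1) s.
      have -> : -1 *: (a - b) + s *: (c - b) = (b + s *: (c - b)) - a.
        by vec_ring.
      by rewrite -e subrr.
    by move=> /eqP; rewrite oppr_eq0 oner_eq0.
  - move=> x [s _ es] [t _ et].
    have [] := abc t (1 - s - t).
      have -> : t *: (b - a) + (1 - s - t) *: (c - a) =
        (c + t *: (b - c)) - (a + s *: (c - a)) by vec_ring.
      by rewrite -et -es subrr.
    by move=> t0 _; rewrite et t0 scale0r addr0.
have [||k k0 hk] := @common_positive_bound _
  (fun (S : edge) k => forall r s t y, 0 <= r -> 0 <= s -> 0 <= t ->
    r + s + t = 1 -> seg S.1 S.2 y ->
    k * Num.min (1 - r) (1 - s) <= `|(r *: a + s *: b + t *: c) - y|) A.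
- move=> S k k' /andP[k0 kk'] h r s t y r0 s0 t0 rst yS.
  apply: le_trans (h r s t y r0 s0 t0 rst yS); rewrite ler_wpM2r //.
  by rewrite le_min; apply/andP; split; lra.
- move=> S SA; apply: tri_seg_bound => //; first exact: nd.
  by move=> x; exact: meet.
rewrite !body_cons /= setUA; apply: (isotopic_tent abc k0).
by move=> r s t y r0 s0 t0 rst [S SA yS]; exact: (hk S).
Qed.

End Delta.

(** * Zigzags *)

Section Zigzag.
Variable R : realType.
Local Notation E3 := 'rV[R]_3.
Local Notation edge := (E3 * E3)%type.

Lemma indep_scale (p q : E3) (s t : R) :
  s != 0 -> t != 0 -> indep p q -> indep (s *: p) (t *: q).
Proof.
move=> s0 t0 pq x y; rewrite !scalerA => /pq [] /eqP + /eqP.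
by rewrite !mulf_eq0 (negbTE s0) (negbTE t0) !orbF => /eqP -> /eqP ->.
Qed.

Lemma indep_sum (p q r : E3) : indep p q -> r = p \/ r = q ->
  indep (p + q) r.
Proof.
move=> pq [] -> x y xy.
  have [] := pq (x + y) x; first by rewrite -[RHS]xy; vec_ring.
  by move=> h1 h2; split; lra.
have [] := pq x (x + y); first by rewrite -[RHS]xy; vec_ring.
by move=> h1 h2; split; lra.
Qed.

Lemma indep_coord (a p q : E3) (g h g' h' : R) : indep p q ->
  a + g *: p + h *: q = a + g' *: p + h' *: q -> g = g' /\ h = h'.
Proof.
move=> pq e; have [] := pq (g - g') (h - h').
  have -> : (g - g') *: p + (h - h') *: q =
    (a + g *: p + h *: q) - (a + g' *: p + h' *: q) by vec_ring.
  by rewrite e subrr.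
by move=> h1 h2; split; lra.
Qed.

(** The teeth are made one by one from [a] onwards: the rest of the edge is subdivided at [P k.+1],
    and its first piece is pushed across the triangle with apex [P k + d k]. *)
Lemma complex_zigzag (a b p q : E3) N (d : nat -> E3) A :
  let P k := a + k%:R *: (p + q) in
  (0 < N)%N -> b = P N -> indep p q -> (forall k, d k = p \/ d k = q) ->
  complex ((a, b) :: A) ->
  (forall k, (k < N)%N -> {in A, forall S x,
     tri (P k) (P k.+1) (P k + d k) x -> seg S.1 S.2 x ->
     x = P k \/ x = P k.+1}) ->
  exists L, [/\ complex (L ++ A),
    ambient_isotopic (body ((a, b) :: A)) (body (L ++ A)) &
    {in L, forall S, S.2 - S.1 = p \/ S.2 - S.1 = q}].
Proof.
move=> P N0 bE pq dE cL hA.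
have PS k : P k.+1 = P k + (p + q) by rewrite /P -natr1; vec_ring.
have triE k x : tri (P k) (P k.+1) (P k + d k) x ->
    exists g h : R, [/\ k%:R <= g <= k.+1%:R, k%:R <= h <= k.+1%:R &
      x = a + g *: p + h *: q].
  move=> [s [t [s0 t0 st ->]]]; rewrite PS -natr1.
  have [->|->] := dE k.
    exists (k%:R + s + t), (k%:R + s); split; [lra|lra|].
    by rewrite /P; vec_ring.
  exists (k%:R + s), (k%:R + s + t); split; [lra|lra|].
  by rewrite /P; vec_ring.
have PE k : P k = a + k%:R *: p + k%:R *: q by rewrite /P; vec_ring.
have indk k : indep (P k.+1 - P k) (P k + d k - P k).
  have -> : P k.+1 - P k = p + q by rewrite PS; vec_ring.
  have -> : P k + d k - P k = d k by vec_ring.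
  exact: indep_sum.
have dirs k : {in [:: (P k, P k + d k); (P k + d k, P k.+1)],
    forall S, S.2 - S.1 = p \/ S.2 - S.1 = q}.
  move=> S; rewrite !inE => /orP[] /eqP -> /=.
    by have -> : P k + d k - P k = d k by vec_ring.
  by rewrite PS; have [->|->] := dE k; [right|left]; vec_ring.
have region k S x : S \in [:: (P k, P k + d k); (P k + d k, P k.+1)] ->
    seg S.1 S.2 x -> tri (P k) (P k.+1) (P k + d k) x.
  rewrite !inE => /orP[] /eqP -> /=; first exact: leg_sub_tri.
  by rewrite seg_sym tri_swap; exact: leg_sub_tri.
(* In the frame [a], [p], [q], both coordinates are at most [k] on the finished teeth and at least
   [k] on the next triangle, so these can share only [P k]. *)
pose inR k (L : seq edge) := {in L, forall S x, seg S.1 S.2 x ->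
  exists g h : R, [/\ g <= k%:R, h <= k%:R & x = a + g *: p + h *: q]}.
have meetR k L S x : inR k L -> S \in L ->
    tri (P k) (P k.+1) (P k + d k) x -> seg S.1 S.2 x ->
    x = P k \/ x = P k.+1.
  move=> hR SL /triE [g [h [/andP[g0 _] /andP[h0 _] xE]]].
  move=> /(hR _ SL) [g' [h' [g'0 h'0 xE']]]; left.
  have [e1 e2] : g = g' /\ h = h' by apply: (@indep_coord a p q) => //; rewrite -xE.
  by rewrite xE PE; congr (_ + _ *: _ + _ *: _); lra.
have claim k : (k < N)%N -> exists L,
    [/\ complex ((P k, b) :: L ++ A),
      ambient_isotopic (body ((a, b) :: A)) (body ((P k, b) :: L ++ A)),
      {in L, forall S, S.2 - S.1 = p \/ S.2 - S.1 = q} & inR k L].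
  elim: k => [_|k IH kN].
    have P0 : P 0%N = a by rewrite /P scale0r addr0.
    by exists [::]; rewrite /= P0; split => //; exact: ambient_isotopic_refl.
  have [L [cLk iso dL rL]] := IH (ltnW kN).
  have kNR : k%:R + 1 < N%:R :> R by rewrite natr1 ltr_nat.
  (* This fraction of the remaining edge leads from [P k] to [P k.+1]. It is less than 1 only if
     something remains beyond, so the last tooth is made separately, without subdivision. *)
  have s01 : 0 < (N%:R - k%:R : R)^-1 < 1.
    by rewrite invr_gt0 subr_gt0 invf_lt1; lra.
  have [+ +] := complex_subdivide cLk s01.
  have -> : P k + (N%:R - k%:R)^-1 *: (b - P k) = P k.+1.
    rewrite PS bE /P; have nz : N%:R - k%:R != 0 :> R by rewrite gt_eqF //; lra.
    have -> : a + N%:R *: (p + q) - (a + k%:R *: (p + q)) =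
      (N%:R - k%:R) *: (p + q) by vec_ring.
    by rewrite scalerA mulVf // scale1r.
  move=> cSub bSub.
  have [S|cD isoD] := complex_delta cSub (indk k).
    rewrite inE mem_cat => /predU1P[->|/orP[SL|SA]] x xt xS; last first.
    - exact: (hA k (ltnW kN) S).
    - exact: (meetR k L S).
    - right; have [g [h [/andP[_ g1] /andP[_ h1] xE]]] := triE _ _ xt.
      move: xS => [t /andP[t0 t1] xE'].
      pose z := k.+1%:R + t * (N%:R - k.+1%:R) : R.
      have [e1 e2] : g = z /\ h = z.
        apply: (@indep_coord a p q) => //; rewrite -xE xE' /= bE /P /z.
        by vec_ring.
      have z1 : k.+1%:R <= z.
        by rewrite lerDl mulr_ge0 // subr_ge0 -natr1 ltW.
      by rewrite xE PE; congr (_ + _ *: _ + _ *: _); lra.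
  exists ((P k, P k + d k) :: (P k + d k, P k.+1) :: L).
  have pe := permEl (perm_catCA [:: (P k, P k + d k); (P k + d k, P k.+1)]
    [:: (P k.+1, b)] (L ++ A)).
  split.
  - exact: complex_perm pe cD.
  - rewrite -(body_perm pe); apply: ambient_isotopic_trans iso _.
    by rewrite -bSub.
  - move=> S; rewrite !inE orbA => /orP[SD|]; last exact: dL.
    by apply: (dirs k); rewrite !inE.
  - move=> S SL x xS; move: SL; rewrite !inE orbA => /orP[SD|SL].
      have /triE [g [h [/andP[_ ?] /andP[_ ?] ->]]] :
        tri (P k) (P k.+1) (P k + d k) x by apply: region xS; rewrite !inE.
      by exists g, h.
    have [g [h [g1 h1 ->]]] := rL S SL x xS.
    by exists g, h; split => //; rewrite -natr1; lra.
have [k kN] : exists k, N = k.+1 by exists N.-1; rewrite prednK.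
have kN' : (k < N)%N by rewrite kN.
have [L [cLk iso dL rL]] := claim k kN'.
have bS : b = P k.+1 by rewrite bE kN.
rewrite bS in cLk iso.
have [S|cD isoD] := complex_delta cLk (indk k).
  rewrite mem_cat => /orP[SL|SA] x xt xS; last exact: (hA k _ S).
  exact: (meetR k L S).
exists ((P k, P k + d k) :: (P k + d k, P k.+1) :: L); split => //.
  by rewrite bS; exact: ambient_isotopic_trans iso isoD.
move=> S; rewrite !inE orbA => /orP[SD|]; last exact: dL.
by apply: (dirs k); rewrite !inE.
Qed.

Lemma complex_flip (a b : E3) A :
  complex ((a, b) :: A) -> complex ((b, a) :: A).
Proof.
have touch_flip x : touches x (b, a) = touches x (a, b).
  by rewrite /touches /= orbC.
move=> [/proper_cons [/= ab mab pA] deg]; split.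
  apply/proper_cons; split => //=; first by rewrite eq_sym.
  by move=> T TA x /=; rewrite seg_sym touch_flip; exact: mab.
by move=> x; have := deg x; rewrite /= touch_flip.
Qed.

Lemma count_le1_eq (T : eqType) (P : pred T) (s : seq T) x y :
  uniq s -> (count P s <= 1)%N -> x \in s -> y \in s -> P x -> P y -> x = y.
Proof.
move=> us c1 xs ys Px Py; apply/eqP/negPn/negP => xy.
have : (size [:: x; y] <= size (seq.filter P s))%N.
  apply: uniq_leq_size; first by rewrite /= inE xy.
  by move=> z; rewrite !inE => /orP[] /eqP ->; rewrite mem_filter ?Px ?Py.
by rewrite size_filter /= => /leq_trans /(_ c1).
Qed.

(* The two cones spanned by b - a with v, resp. with w, meet only in the ray
   through b, so an edge leaving a enters at most one of them. *)
Lemma choose_side (a b v w : E3) A :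
  complex ((a, b) :: A) -> b - a = v + w -> indep v w ->
  exists2 r, r = v \/ r = w &
    {in A, forall S x, touches a S -> seg S.1 S.2 x ->
       forall s t : R, 0 <= s -> 0 <= t -> x = a + s *: (b - a) + t *: r ->
       x = a}.
Proof.
move=> cL bE vw.
have [[/proper_cons [/= ab mab [uA _ _]] _] deg] := (cL, cL.2).
have [[S [x [SA aS xS [s [t [s0 t0 xE xa]]]]]]|no] := pselect (exists S x,
  [/\ S \in A, touches a S, seg S.1 S.2 x & exists s t : R,
  [/\ 0 <= s, 0 <= t, x = a + s *: (b - a) + t *: v & x != a]]); last first.
  exists v; first by left.
  move=> S SA x aS xS s t s0 t0 xE; apply/eqP/negPn/negP => xa.
  by apply: no; exists S, x; split => //; exists s, t.
exists w; first by right.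
move=> S' S'A x' aS' x'S' s' t' s'0 t'0 xE'.
(* The edge [(a, b)] takes one of the two places at [a], so [S] and [S'] are the same edge. *)
have deg1 : (count (touches a) A <= 1)%N.
  by have := deg a; rewrite /= {1}/touches /= eqxx add1n ltnS.
have SS' := count_le1_eq uA deg1 SA S'A aS aS'; rewrite -{}SS' {S' S'A aS'} in x'S'.
apply/eqP/negPn/negP => xa'.
have [q segq] : exists q, seg S.1 S.2 = seg a q.
  case/orP: aS => /eqP ->; first by exists S.2.
  by exists S.1; rewrite seg_sym.
move: xS x'S'; rewrite segq => -[g /andP[g0 g1] gE] [g' /andP[g'0 g'1] gE'].
have gp : 0 < g.
  rewrite lt_neqAle g0 andbT; apply: contraNneq xa => g00.
  by rewrite gE -g00 scale0r addr0.
have g'p : 0 < g'.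
  rewrite lt_neqAle g'0 andbT; apply: contraNneq xa' => g00.
  by rewrite gE' -g00 scale0r addr0.
(* Since [x] and [x'] lie on one ray from [a], the vectors [g' *: (x - a)] and [g *: (x' - a)]
   agree. Their coefficients give [g' * t = - (g * t')], hence [t = 0], and [x] is on the ray
   through [b]. *)
have [e1 e2] : g' * (s + t) = g * s' /\ g' * s = g * (s' + t').
  apply: (@indep_coord a v w) => //.
  have -> : a + (g' * (s + t)) *: v + (g' * s) *: w =
    a + g' *: ((a + s *: (v + w) + t *: v) - a) by vec_ring.
  have -> : a + (g * s') *: v + (g * (s' + t')) *: w =
    a + g *: ((a + s' *: (v + w) + t' *: w) - a) by vec_ring.
  by rewrite -bE -xE -xE' gE gE'; vec_ring.
have gt : g' * t = 0.
  apply/eqP; rewrite eq_le mulr_ge0 // andbT.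
  have : 0 <= g * t' by rewrite mulr_ge0.
  lra.
have t00 : t = 0 by move/eqP: gt; rewrite mulf_eq0 gt_eqF //= => /eqP.
rewrite t00 scale0r addr0 in xE.
have sp : 0 < s.
  rewrite lt_neqAle s0 andbT; apply: contraNneq xa => s00.
  by rewrite xE -s00 scale0r addr0.
(* Shrinking by [l] towards [a] keeps the point on [S] and brings it strictly inside the edge from
   [a] to [b], where [S] may not pass. *)
pose l := (1 + s)^-1; pose y := a + (l * s) *: (b - a).
have s1 : 0 < 1 + s by lra.
have l0 : 0 < l by rewrite invr_gt0.
have l1 : l < 1 by rewrite invf_lt1 // ltrDl.
have ls0 : 0 < l * s by rewrite mulr_gt0.
have ls1 : l * s < 1 by rewrite mulrC ltr_pdivrMr // mul1r ltrDr.
have ySeg : seg a b y by exists (l * s) => //; rewrite !ltW.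
have yS : seg S.1 S.2 y.
  rewrite segq; exists (l * g); first by apply/andP; split; nra.
  rewrite -!scalerA /y -scalerA; congr (_ + _ *: _).
  by apply: (addrI a); rewrite -xE -gE.
have [/orP[] /= /eqP e _] := mab S SA y ySeg yS.
  move: e; rewrite /y -[RHS]addr0 => /addrI /eqP.
  by rewrite scaler_eq0 gt_eqF //= subr_eq0 eq_sym (negbTE ab).
have : (l * s - 1) *: (b - a) = 0.
  have -> : (l * s - 1) *: (b - a) = y - b by rewrite /y; vec_ring.
  by rewrite e subrr.
move/eqP; rewrite scaler_eq0 !subr_eq0 lt_eqF //= eq_sym.
by rewrite (negbTE ab).
Qed.

End Zigzag.

(** * Axis-parallel complexes *)

Section AxisParallel.
Variable R : realType.
Local Notation E3 := 'rV[R]_3.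
Local Notation edge := (E3 * E3)%type.

(** Against an edge that shares an endpoint with [(a, b)], only the half of [(a, b)] away from that
    endpoint is considered. What remains is compact and disjoint from the other edge. *)
Lemma dist_away_from_ends (a b : E3) A :
  complex ((a, b) :: A) ->
  exists2 e : R, 0 < e & {in A, forall S (s : R) y, 0 <= s <= 1 ->
    seg S.1 S.2 y -> (touches a S -> 2^-1 <= s) -> (touches b S -> s <= 2^-1) ->
    e <= `|a + s *: (b - a) - y|}.
Proof.
move=> [/proper_cons [/= ab mab _] _].
apply: (@common_positive_bound _ _ (fun (S : edge) e => forall (s : R) y,
  0 <= s <= 1 -> seg S.1 S.2 y -> (touches a S -> 2^-1 <= s) ->
  (touches b S -> s <= 2^-1) -> e <= `|a + s *: (b - a) - y|)).
  move=> S k k' /andP[_ kk'] h s y s01 yS ha hb.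
  exact: le_trans kk' (h s y s01 yS ha hb).
move=> S SA.
(* If [S] touches both [a] and [b], only the midpoint remains. *)
pose lo : R := if touches a S then 2^-1 else 0.
pose hi : R := if touches b S then 2^-1 else 1.
have lohi : lo <= hi by rewrite /lo /hi; do 2 case: ifP => _; lra.
have lo0 : 0 <= lo by rewrite /lo; case: ifP => _; lra.
have hi1 : hi <= 1 by rewrite /hi; case: ifP => _; lra.
pose Z := (fun s : R => a + s *: (b - a)) @` `[lo, hi].
have cZ : compact Z.
  apply: continuous_compact; last exact: segment_compact.
  apply: continuous_subspaceT => s; apply: cvgD; first exact: cvg_cst.
  by apply: cvgZ; [exact: cvg_id|exact: cvg_cst].
have ba0 : b - a != 0 by rewrite subr_eq0 eq_sym.
have inj (t : R) : t *: (b - a) = 0 -> t = 0.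
  by move=> /eqP; rewrite scaler_eq0 (negbTE ba0) orbF => /eqP.
have [|e e0 he] := compact_disjoint_dist cZ (@compact_seg R S.1 S.2).
  apply/seteqP; split => // x [[s]]; rewrite /= in_itv /= => /andP[s0 s1] xE xS.
  have xab : seg a b x.
    by exists s => //; rewrite (le_trans lo0 s0) (le_trans s1 hi1).
  have [/orP[] /= /eqP xe xT] := mab S SA x xab xS.
    rewrite xe in xT; move: s0; rewrite /lo xT.
    have -> : s = 0; last lra.
    apply: inj; have -> : s *: (b - a) = (a + s *: (b - a)) - a by vec_ring.
    by rewrite xE xe subrr.
  rewrite xe in xT; move: s1; rewrite /hi xT.
  have s1 : s - 1 = 0; last lra.
  apply: inj; have -> : (s - 1) *: (b - a) = (a + s *: (b - a)) - b by vec_ring.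
  by rewrite xE xe subrr.
exists e => // s y /andP[s0 s1] yS ha hb; apply: he => //.
exists s => //; rewrite /= in_itv /= /lo /hi; apply/andP; split.
  by case: ifP => // /ha.
by case: ifP => // /hb.
Qed.

(** The first half of the teeth lies on the side chosen at [a], the second half on the side chosen
    at [b]. The teeth are so low that they could meet only edges ending at the endpoint of their own
    half, and the choice of side excludes this outside the endpoint. *)
Lemma complex_split_edge (a b v w : E3) A :
  complex ((a, b) :: A) -> b - a = v + w -> indep v w ->
  exists L, [/\ complex (L ++ A),
    ambient_isotopic (body ((a, b) :: A)) (body (L ++ A)) &
    {in L, forall S, exists t : R, S.2 - S.1 = t *: v \/ S.2 - S.1 = t *: w}].
Proof.
move=> cL bE vw.
have [v1 v1E ha] := choose_side cL bE vw.
have aE : a - b = - v + - w by rewrite -opprD -bE opprB.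
have vw' : indep (- v) (- w).
  by rewrite -(scaleN1r v) -(scaleN1r w); apply: indep_scale;
    rewrite // oppr_eq0 oner_eq0.
have [r rE hb] := choose_side (complex_flip cL) aE vw'.
(* Seen from [b], a tooth is traversed backwards: its first leg has direction [v2 - (v + w) = r]. *)
pose v2 := v + w + r.
have v2E : v2 = v \/ v2 = w.
  by rewrite /v2; case: rE => ->; [right|left]; vec_ring.
have [e e0 he] := dist_away_from_ends cL.
pose V := `|v| + `|w|.
have V0 : 0 <= V by rewrite addr_ge0.
(* A point of a tooth differs by at most [V / N] from a point of the edge, and this choice makes
   [V / N < e]. *)
pose M := (Num.truncn (V / e)).+1.
have VM : V / e < M%:R by rewrite truncnS_gt.
have M0 : 0 < M%:R :> R by rewrite ltr0n.
pose N := (M + M)%N.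
have NE : N%:R = M%:R + M%:R :> R by rewrite natrD.
have Np : 0 < N%:R :> R by rewrite NE addr_gt0.
have Nn : N%:R != 0 :> R by rewrite gt_eqF.
have VN : V / N%:R < e.
  rewrite ltr_pdivrMr // mulrC -ltr_pdivrMr // NE.
  by apply: lt_trans VM _; rewrite ltrDl.
pose vk (k : nat) := if (k < M)%N then v1 else v2.
have vkE k : vk k = v \/ vk k = w by rewrite /vk; case: ifP.
have vkV k : `|vk k| <= V.
  by case: (vkE k) => ->; rewrite /V ?lerDl ?lerDr.
pose p := N%:R^-1 *: v; pose q := N%:R^-1 *: w.
pose d k := N%:R^-1 *: vk k.
have PE k : a + k%:R *: (p + q) = a + (k%:R / N%:R) *: (b - a).
  by rewrite bE /p /q -scalerDr scalerA.
have PN : b = a + N%:R *: (p + q).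
  by rewrite PE divff // scale1r addrC subrK.
have pq : indep p q by apply: indep_scale; rewrite ?invr_eq0.
have dE k : d k = p \/ d k = q.
  by rewrite /d /p /q; case: (vkE k) => ->; [left|right].
have N0 : (0 < N)%N by [].
have [k kN S SA x xt xS|L [cLA iso dirs]] := complex_zigzag N0 PN pq dE cL.
  have [s [t [s0 t0 st xE]]] := xt.
  pose g := (k%:R + s) / N%:R; pose h := t / N%:R.
  have kN1 : k%:R + 1 <= N%:R :> R by rewrite natr1 ler_nat.
  have g0 : 0 <= g by rewrite divr_ge0 // addr_ge0.
  have g1 : g <= 1 by rewrite ler_pdivrMr // mul1r; lra.
  have h0 : 0 <= h by rewrite divr_ge0.
  have {}xE : x = a + g *: (b - a) + h *: vk k.
    by rewrite xE !PE -natr1 /g /h /d; vec_field.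
  (* Hence a common point with [S] in the first half forces [S] to touch [a], and one in the second
     half forces [S] to touch [b]. *)
  have near : (touches a S -> 2^-1 <= g) -> (touches b S -> g <= 2^-1) -> False.
    move=> tA tB; have := he S SA g x _ xS tA tB; rewrite g0 g1 => /(_ isT).
    have -> : a + g *: (b - a) - x = - (h *: vk k) by rewrite xE; vec_ring.
    rewrite normrN normrZ ger0_norm // leNgt => /negP; apply.
    apply: le_lt_trans VN; rewrite /h mulrAC.
    rewrite ler_pM2r ?invr_gt0 //; apply: (@le_trans _ _ (1 * V)).
      by apply: ler_pM => //; lra.
    by rewrite mul1r.
  have [kM|Mk] := ltnP k M.
    have gh : g <= 2^-1.
      rewrite ler_pdivrMr // NE.
      have : k%:R + 1 <= M%:R :> R by rewrite natr1 ler_nat.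
      lra.
    have [tA|tA] := boolP (touches a S); last by case: near; rewrite // (negbTE tA).
    have vkE1 : vk k = v1 by rewrite /vk kM.
    have xa : x = a by apply: (ha S SA x tA xS g h) => //; rewrite xE vkE1.
    have [gz _] : g = 0 /\ h = 0.
      apply: (indep_sum vw v1E); rewrite -bE -vkE1.
      have -> : g *: (b - a) + h *: vk k = x - a by rewrite xE; vec_ring.
      by rewrite xa subrr.
    move/eqP: gz; rewrite mulf_eq0 invr_eq0 (negbTE Nn) orbF => /eqP ks0.
    left; rewrite xa; have -> : k%:R = 0 :> R; last by rewrite scale0r addr0.
    by have := ler0n R k; lra.
  have gh : 2^-1 <= g.
    rewrite ler_pdivlMr // NE.
    have : M%:R <= k%:R :> R by rewrite ler_nat.
    lra.
  have [tB|tB] := boolP (touches b S); last by case: near; rewrite // (negbTE tB).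
  have vkE2 : vk k = v2 by rewrite /vk ltnNge Mk.
  (* The same point in the frame at [b] in which the side [r] was chosen. *)
  have xE' : x = b + (1 - g - h) *: (a - b) + h *: r.
    rewrite xE vkE2 /v2 -bE; vec_ring.
  have gh1 : 0 <= 1 - g - h.
    have -> : 1 - g - h = (N%:R - k%:R - s - t) / N%:R by rewrite /g /h; field.
    by rewrite divr_ge0 //; lra.
  have xb : x = b by apply: (hb S SA x tB xS (1 - g - h) h).
  have [gz hz] : 1 - g - h = 0 /\ h = 0.
    apply: (indep_sum vw' rE); rewrite -aE.
    have -> : (1 - g - h) *: (a - b) + h *: r = x - b by rewrite xE'; vec_ring.
    by rewrite xb subrr.
  right; rewrite xb PN; congr (_ + _ *: _).
  have : g * N%:R = N%:R by have -> : g = 1; [lra|rewrite mul1r].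
  by rewrite /g divfK // -natr1 => ks; lra.
exists L; split => // S SL; exists N%:R^-1; exact: dirs.
Qed.

(** Orthogonal or parallel to axis [i]. *)
Definition good (i : 'I_3) (u : E3) : bool :=
  (u 0 i == 0) || [forall j, (j != i) ==> (u 0 j == 0)].

Definition good_edge i (S : edge) := good i (S.2 - S.1).

Lemma goodZ i t u : good i u -> good i (t *: u).
Proof.
move=> /orP[/eqP u0|/forallP h]; apply/orP.
  by left; rewrite mxE u0 mulr0.
right; apply/forallP => j; apply/implyP => ji.
by have := h j; rewrite ji /= => /eqP uj; rewrite mxE uj mulr0.
Qed.

(** Induction on the number of bad edges. A bad edge is split along its component [v] on axis [i]
    and the remainder [w], which are parallel and orthogonal to that axis. Goodness for another axis
    survives: a vector with a non-zero component on axis [i] can only have it by orthogonality,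
    which [v] and [w] inherit. *)
Lemma complex_make_good i L :
  complex L -> exists L', [/\ complex L',
    ambient_isotopic (body L) (body L'), all (good_edge i) L' &
    forall j, all (good_edge j) L -> all (good_edge j) L'].
Proof.
have [n] := ubnP (count (predC (good_edge i)) L).
elim: n L => // n IH L cn cL.
have [hg|] := boolP (all (good_edge i) L).
  by exists L; split => //; exact: ambient_isotopic_refl.
move=> /allPn [[a b] SL bad].
have pe := perm_to_rem SL; set A := rem (a, b) L in pe.
have cA := complex_perm pe cL.
pose u := b - a; pose v : E3 := u 0 i *: delta_mx 0 i; pose w := u - v.
move: (bad); rewrite /good_edge /good /= negb_or -/u => /andP[ui].
rewrite negb_forall => /existsP [j]; rewrite negb_imply => /andP[ji uj].
have vi : v 0 i = u 0 i by rewrite !mxE !eqxx mulr1.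
have vj l : l != i -> v 0 l = 0 by move=> li; rewrite !mxE (negbTE li) andbF mulr0.
have wE l : w 0 l = u 0 l - v 0 l by rewrite !mxE.
have vw : indep v w.
  move=> s t st.
  have stl l : s * v 0 l + t * w 0 l = 0.
    by have := congr1 (fun M : E3 => M 0 l) st; rewrite !mxE.
  have t0 : t = 0.
    have := stl j; rewrite wE vj // mulr0 add0r subr0 => /eqP.
    by rewrite mulf_eq0 (negbTE uj) orbF => /eqP.
  split => //; have := stl i; rewrite t0 mul0r addr0 vi => /eqP.
  by rewrite mulf_eq0 (negbTE ui) orbF => /eqP.
have uE : b - a = v + w by rewrite [RHS]addrC subrK.
have [Z [cZ isoZ dirs]] := complex_split_edge cA uE vw.
have gv : good i v.
  apply/orP; right; apply/forallP => l; apply/implyP => li.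
  by rewrite vj.
have gw : good i w by apply/orP; left; rewrite wE vi subrr.
have goodZi : all (good_edge i) Z.
  apply/allP => S SZ; rewrite /good_edge.
  by have [t [->|->]] := dirs S SZ; exact: goodZ.
have [|L' [cL' iso' gL' pL']] := IH (Z ++ A) _ cZ.
  rewrite count_cat; have -> : count (predC (good_edge i)) Z = 0%N.
    by apply/eqP; rewrite -leqn0 leqNgt -has_count has_predC goodZi.
  rewrite add0n; move: cn; rewrite (permP pe) /= bad add1n ltnS; exact.
exists L'; split => //.
  apply: ambient_isotopic_trans iso'.
  by rewrite (body_perm pe).
move=> l gl; apply: pL'; move: gl; rewrite (perm_all _ pe) /= all_cat.
move=> /andP[gab ->]; rewrite andbT; apply/allP => S SZ; rewrite /good_edge.
have [gvl gwl] : good l v /\ good l w.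
  move: gab; rewrite /good_edge /good /= -/u => /orP[/eqP ul|/forallP h].
    have li : l != i by apply: contraNneq ui => <-; rewrite ul.
    by rewrite wE vj // ul subr0 eqxx.
  have il : l = i.
    apply/eqP/negPn/negP => li; move: ui; have := h i.
    by rewrite eq_sym li /= => /eqP ->; rewrite eqxx.
  by rewrite il.
by have [t [->|->]] := dirs S SZ; exact: goodZ.
Qed.

Definition axis_parallel (S : edge) : Prop :=
  exists k : 'I_3, forall j, j != k -> S.1 0 j = S.2 0 j.

(** Axes 0 and 1 suffice: an edge orthogonal to both is parallel to axis 2. *)
Lemma complex_axis_parallel L :
  complex L -> exists2 L', ambient_isotopic (body L) (body L') &
    {in L', forall S, axis_parallel S}.
Proof.
move=> cL.
have [L1 [c1 iso1 g1 _]] := complex_make_good 0 cL.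
have [L2 [c2 iso2 g2 p2]] := complex_make_good 1 c1.
exists L2; first exact: ambient_isotopic_trans iso1 iso2.
move=> S SL; have := allP (p2 0 g1) S SL; have := allP g2 S SL.
rewrite /good_edge /good.
have coord j : ((S.2 - S.1) 0 j == 0) = (S.2 0 j == S.1 0 j).
  by rewrite !mxE subr_eq0.
move=> /orP[h1|/forallP h1]; last first.
  move=> _; exists 1 => j j1; have := h1 j.
  by rewrite j1 coord => /eqP.
move=> /orP[h0|/forallP h0]; last first.
  by exists 0 => j j1; have := h0 j; rewrite j1 coord => /eqP.
move: h0 h1; rewrite !coord => /eqP h0 /eqP h1; exists 2%:R => j.
case: j => [[|[|[|//]]] hj] j2.
- by have -> : Ordinal hj = 0 by apply: val_inj.
- by have -> : Ordinal hj = 1 by apply: val_inj.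
- by move/eqP: j2; case; apply: val_inj.
Qed.

End AxisParallel.

(** * Polygons and coordinate changes *)

Section PolygonComplex.
Variable R : realType.
Local Notation E3 := 'rV[R]_3.
Local Notation edge := (E3 * E3)%type.

(** Degrees are at most 2 because [p] and the cyclic successor are injective: a point starts at most
    one edge and ends at most one. *)
Lemma simple_closed_polygon_complex (P : set E3) :
  simple_closed_polygon P -> exists2 L, complex L & P = body L.
Proof.
move=> [n [p [n2 pinj ->]]].
have zI : (0 : R) \in `[0, 1[ by rewrite in_itv /= lexx ltr01.
have pt0 i : polygon_pt p i 0 = p i.
  by rewrite /polygon_pt subr0 scale1r scale0r addr0.
have ptE i s : polygon_pt p i s = p i + s *: (p (ordS i) - p i).
  by rewrite /polygon_pt; vec_ring.
have pI : injective p.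
  by move=> i j e; have [] := pinj i j 0 0 zI zI; rewrite ?pt0.
have pSI : injective (p \o @ordS n) by apply: inj_comp => //; exact: ordS_inj.
have hI : (2^-1 : R) \in `[0, 1[ by rewrite in_itv /=; lra.
(* The hypothesis speaks of half-open edges; the missing endpoint is the start of the next one. *)
have segP i x : seg (p i) (p (ordS i)) x ->
    (exists2 s, s \in `[0, 1[ & x = polygon_pt p i s) \/ x = p (ordS i).
  move=> [s /andP[s0 s1] ->]; have [s_lt1|s_ge1] := ltP s 1.
    by left; exists s; rewrite ?in_itv /= ?s0 ?ptE.
  right; have -> : s = 1 by lra.
  by vec_ring.
pose e i : edge := (p i, p (ordS i)).
have count1 (f : 'I_n -> E3) x : injective f ->
    (count (fun i => x == f i) (enum 'I_n) <= 1)%N.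
  move=> fI; have u : uniq (map f (enum 'I_n)) by rewrite map_inj_uniq ?enum_uniq.
  have := count_uniq_mem x u; rewrite count_map => h.
  rewrite (@eq_count _ _ (preim f (pred1 x))); last by move=> i /=; rewrite eq_sym.
  by rewrite h leq_b1.
exists [seq e i | i <- enum 'I_n].
  split.
    split.
    - by rewrite map_inj_uniq ?enum_uniq // => i j [/pI].
    - move=> S /mapP [i _ ->] /=; apply/eqP => pp.
      have [] := pinj i i 0 2^-1 zI hI; last by move=> _; lra.
      by rewrite pt0 ptE -pp subrr scaler0 addr0.
    - move=> S T /mapP [i _ ->] /mapP [j _ ->] ij x /segP + /segP.
      have {}ij : i != j by apply: contraNneq ij => ->.
      rewrite /touches /=.
      move=> [[s sI xs]|->] [[t tI xt]|xt].
      + have [eij _] := pinj i j s t sI tI (esym (etrans (esym xt) xs)).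
        by rewrite eij eqxx in ij.
      + have [eij _] : i = ordS j /\ s = 0 by apply: pinj; rewrite // -xs pt0.
        by rewrite xt eij !eqxx orbT.
      + have [eij _] : ordS i = j /\ 0 = t by apply: pinj; rewrite // -xt pt0.
        by rewrite eij !eqxx orbT.
      + by rewrite -xt !eqxx !orbT.
  move=> x; rewrite count_map.
  have := count1 p x pI; have := count1 _ x pSI => h1 h2.
  apply: leq_trans (leq_add h2 h1).
  by rewrite -count_predUI leq_addr.
apply/seteqP; split => x.
  move=> [i [s]]; rewrite in_itv /= => /andP[s0 s1] ->; exists (e i).
    by rewrite map_f // mem_enum.
  by exists s; [rewrite s0 ltW|rewrite ptE].
move=> [S /mapP [i _ ->] /segP [[s sI ->]|->]]; first by exists i, s.
by exists (ordS i), 0; rewrite ?pt0.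
Qed.

(** A piecewise linear map, built from left to right: it starts with slope 1, and each further node
    changes the slope beyond the previous one. The constants [c] and [C] bound the slopes. *)
Lemma interpolation (r y : nat -> R) n :
  (forall j, (j < n)%N -> r j < r j.+1) ->
  (forall j, (j < n)%N -> y j < y j.+1) ->
  exists f : R -> R, exists c C : R, [/\ 0 < c,
    forall x z, x <= z -> c * (z - x) <= f z - f x <= C * (z - x) &
    forall j, (j <= n)%N -> f (r j) = y j].
Proof.
elim: n => [_ _|n IH hr hy].
  exists (fun x => y 0%N + (x - r 0%N)), 1, 1; split => //.
    by move=> x z xz; apply/andP; split; lra.
  by move=> j; rewrite leqn0 => /eqP ->; rewrite subrr addr0.
have [||f [c [C [c0 fcC fr]]]] := IH.
- by move=> j jn; apply: hr; rewrite ltnW.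
- by move=> j jn; apply: hy; rewrite ltnW.
have dr : 0 < r n.+1 - r n by rewrite subr_gt0 hr.
have dy : 0 < y n.+1 - y n by rewrite subr_gt0 hy.
pose s := (y n.+1 - y n) / (r n.+1 - r n).
have s0 : 0 < s by rewrite divr_gt0.
have rmono j : (j <= n)%N -> r j <= r n.
  move=> jn; have : forall m, (j + m <= n)%N -> r j <= r (j + m)%N.
    elim=> [|m IHm jm]; first by rewrite addn0.
    rewrite addnS; apply: le_trans (IHm _) (ltW (hr _ _)).
      by rewrite (leq_trans _ jm) // addnS.
    by rewrite ltnS (leq_trans _ jm) // addnS.
  by move=> /(_ (n - j)%N); rewrite subnKC //; apply.
exists (fun x => if x <= r n then f x else y n + s * (x - r n)).
exists (Num.min c s), (Num.max C s); split.
- by rewrite lt_min c0.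
- have mc : Num.min c s <= c by rewrite ge_min lexx.
  have ms : Num.min c s <= s by rewrite ge_min lexx orbT.
  have MC : C <= Num.max C s by rewrite le_max lexx.
  have Ms : s <= Num.max C s by rewrite le_max lexx orbT.
  move: mc ms MC Ms; move: (Num.min c s) (Num.max C s) => m M mc ms MC Ms.
  have bnd k w : 0 <= w -> m <= k <= M -> m * w <= k * w <= M * w.
    by move=> w0 /andP[? ?]; rewrite !ler_wpM2r.
  have bC w : 0 <= w -> m * w <= c * w /\ C * w <= M * w.
    by move=> w0; rewrite !ler_wpM2r.
  have bs w : 0 <= w -> m * w <= s * w /\ s * w <= M * w.
    by move=> w0; rewrite !ler_wpM2r.
  move=> x z xz; have [xr|xr] := leP x (r n); have [zr|zr] := leP z (r n).
  + have /andP[h1 h2] := fcC x z xz.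
    have [] := bC (z - x); first by rewrite subr_ge0.
    by move=> h3 h4; apply/andP; split; lra.
  + have /andP[h1 h2] := fcC x (r n) xr; rewrite (fr n (leqnn _)) in h1 h2.
    have [|h3 h4] := bC (r n - x); first by rewrite subr_ge0.
    have [|h5 h6] := bs (z - r n); first by rewrite subr_ge0 ltW.
    by apply/andP; split; lra.
  + by have := lt_le_trans xr xz; rewrite ltNge zr.
  + have [|h5 h6] := bs (z - x); first by rewrite subr_ge0.
    by apply/andP; split; lra.
- move=> j; rewrite leq_eqVlt => /orP[/eqP ->|jn]; last first.
    by rewrite rmono // fr.
  rewrite leNgt -subr_gt0 dr /= /s divfK ?gt_eqF //.
  by rewrite addrC subrK.
Qed.

(** At each time in [[0, 1]] a coordinate is moved by a convex combination of the identity and [f],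
    which expands distances by at least [Num.min c 1], while the displacement is Lipschitz with
    constant [C + 1]. The sup norm carries this from coordinates to vectors. *)
Lemma isotopic_coordinatewise (f : R -> R) (c C : R) (B : set E3) :
  B !=set0 -> 0 < c ->
  (forall x z, x <= z -> c * (z - x) <= f z - f x <= C * (z - x)) ->
  ambient_isotopic B ((fun x : E3 => \row_i f (x 0 i)) @` B).
Proof.
move=> B0 c0 fcC.
have cC : c <= C by have /andP[+] := fcC 0 1 ler01; lra.
pose c1 := Num.min c 1.
have c10 : 0 < c1 by rewrite lt_min c0 ltr01.
have c1c : c1 <= c by rewrite ge_min lexx.
have c11 : c1 <= 1 by rewrite ge_min lexx orbT.
have real x z t : 0 <= t <= 1 ->
    `|(f x - x) - (f z - z)| <=
    (C + 1) / c1 * `|x + t * (f x - x) - (z + t * (f z - z))|.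
  wlog zx : x z / z <= x => [H|].
    have [zx|/ltW xz] := leP z x; first exact: H.
    by rewrite distrC [X in _ <= _ * X]distrC; exact: H.
  move=> /andP[t0 t1]; have /andP[h1 h2] := fcC z x zx.
  have w0 : 0 <= x - z by rewrite subr_ge0.
  apply: (@le_trans _ _ ((C + 1) * (x - z))).
    have : 0 <= c * (x - z) by rewrite mulr_ge0 // ltW.
    by rewrite ler_norml => ?; apply/andP; split; lra.
  rewrite -mulrA ler_wpM2l //; first lra.
  rewrite ler_pdivlMl //; apply: le_trans (ler_norm _).
  have -> : x + t * (f x - x) - (z + t * (f z - z)) =
    (1 - t) * (x - z) + t * (f x - f z) by ring.
  have a1 : (1 - t) * (c1 * (x - z)) <= (1 - t) * (x - z).
    by rewrite ler_wpM2l ?subr_ge0 // ler_piMl.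
  have a2 : t * (c1 * (x - z)) <= t * (f x - f z).
    by rewrite ler_wpM2l // (le_trans _ h1) // ler_wpM2r.
  lra.
have := @isotopic_displacement R _ B id (fun x => \row_i f (x 0 i) - x)
  ((C + 1) / c1) B0.
rewrite image_id (@eq_imagel _ _ B (fun i => id i + (\row_i0 f (i 0 i0) - i))
  (fun x : E3 => \row_i f (x 0 i))); last by move=> x _; rewrite addrC subrK.
apply => x z t _ _ t01; apply: ler_rV_norm => [|i].
  by rewrite mulr_ge0 // divr_ge0 ?ltW //; lra.
have := real (x 0 i) (z 0 i) t t01; rewrite !mxE => /le_trans; apply.
rewrite ler_wpM2l //; first by rewrite divr_ge0 ?ltW //; lra.
have := ler_coord_norm (x + t *: (\row_i f (x 0 i) - x) -
  (z + t *: (\row_i f (z 0 i) - z))) i.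
by rewrite !mxE.
Qed.

End PolygonComplex.

(** * The one-skeleton of the Menger sponge *)

(** In units of [3 ^- n], the left ends of the intervals in the [n]-th stage of the Cantor set. *)
Fixpoint cantor_corner (n b : nat) : bool :=
  if n is m.+1 then cantor_corner m (b %/ 3) && (b %% 3 != 1)%N else b == 0%N.

Lemma cantor_corner_pow3 n j : (j < n)%N -> cantor_corner n (2 * 3 ^ j).
Proof.
have c0 m : cantor_corner m 0 by elim: m => //= m ->.
elim: n j => // n IH [_|j jn] /=; first by rewrite expn0 muln1 /= c0.
by rewrite expnS mulnCA mulKn // modnMr andbT; exact: IH.
Qed.

Lemma third_ord (k i : 'I_3) : exists j : 'I_3, (j != k) && (j != i).
Proof.
exists (if (0 != k) && (0 != i) then 0
        else if (1 != k) && (1 != i) then 1 else 2%:R).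
by move: k i; do 2![case=> [[|[|[|//]]] ?]].
Qed.

(** At each level a removed subcube has digit 1 in all directions but at most one, say [i]; a
    direction other than [k] and [i] then contradicts the Cantor condition. *)
Lemma menger_corner_line n (a : {ffun 'I_3 -> nat}) k :
  (forall j, j != k -> cantor_corner n (a j)) -> (a k < 3 ^ n)%N ->
  menger_corner n a.
Proof.
elim: n a => [|n IH] a ha hk.
  apply/ffunP => j; rewrite ffunE.
  have [->|jk] := eqVneq j k; first by case: (a k) hk.
  exact/eqP/ha.
pose d : {ffun 'I_3 -> 'I_3} := [ffun i => inord (a i %% 3)%N].
have dE i : d i = (a i %% 3)%N :> nat by rewrite ffunE inordK // ltn_mod.
exists [ffun i => a i %/ 3]%N, d; split.
- apply: IH => [j jk|].
    by rewrite ffunE; have := ha j jk => /= /andP[].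
  by rewrite ffunE ltn_divLR // mulnC -expnS.
- move=> dc; have [j /andP[jk _]] := third_ord k k.
  by have := ha j jk => /= /andP[_]; rewrite -dE dc.
- move=> [i _ dc]; have [j /andP[jk ji]] := third_ord k i.
  by have := ha j jk => /= /andP[_]; rewrite -dE dc.
- by apply/ffunP => i; rewrite !ffunE inordK ?ltn_mod // mulnC -divn_eq.
Qed.

Section MengerEdges.
Variable R : realType.
Local Notation E3 := 'rV[R]_3.

(** The last digit in direction [k] decides whether the subcube is central or face-central; it is
    removed in both cases. *)
Lemma menger_corner_two_central n (a : {ffun 'I_3 -> nat}) k :
  (forall j, j != k -> a j %% 3 = 1)%N -> ~ menger_corner n.+1 a.
Proof.
move=> ha [a' [d [_ nc nf aE]]].
have dE i : d i = (a i %% 3)%N :> nat.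
  by rewrite aE ffunE mulnC modnMDl modn_small // ltn_ord.
have [dk|dk] := eqVneq (d k : nat) 1%N.
  by apply: nc => i; have [->//|ik] := eqVneq i k; rewrite dE ha.
apply: nf; exists k; last by move=> j jk; rewrite dE ha.
by move: dk; case: (d k) => [[|[|[|//]]] ?] //= _; [left|right].
Qed.

(* Just below such an edge, both transverse digits are 1, and such a cube is
   not kept. *)
Lemma cube_edge_boundary n (a : {ffun 'I_3 -> nat}) k :
  menger_corner n.+1 a -> (forall j, j != k -> a j %% 3 = 2)%N ->
  @cube_edge R n.+1 a k (fun=> false) `<=` boundary (menger n.+1).
Proof.
move=> ma ha x [xa xE]; split; first by apply: subset_closure; exists a.
move=> /nbhs_ballP [e /= e0 xe].
set q : R := 3 ^+ n.+1 in xa xE *.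
have q0 : 0 < q by rewrite exprn_gt0.
(* Small enough to stay in the ball, and at most half a side, so that the shifted point is inside
   the layer of cubes just below. *)
pose h := Num.min (e / 2) (q^-1 / 2).
have h0 : 0 < h by rewrite lt_min !divr_gt0 // invr_gt0.
have he : h < e.
  by rewrite /h gt_min; apply/orP; left; rewrite ltr_pdivrMr //; lra.
have hq0 : 0 < h * q by rewrite mulr_gt0.
have hq : h * q <= 2^-1.
  have : h <= q^-1 / 2 by rewrite /h ge_min lexx orbT.
  by rewrite -(ler_pM2r q0) mulrAC mulVf ?gt_eqF // mul1r.
pose x' : E3 := x - h *: \row_j (j != k)%:R.
have [|a' ma' x'a'] := xe x'.
  rewrite -ball_normE /= /x' opprB addrCA subrr addr0.
  apply: le_lt_trans he; apply: ler_rV_norm => [|j]; first exact: ltW.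
  by rewrite !mxE normrM gtr0_norm // normr_nat; case: (_ != _);
    rewrite ?mulr1 ?mulr0 // ltW.
apply: (@menger_corner_two_central n a' k) ma' => j jk.
have /andP[] := x'a' j; rewrite -/q.
have -> : x' 0 j = (a j)%:R / q - h.
  by rewrite !mxE jk mulr1 xE // addn0.
rewrite ler_pdivrMr // ler_pdivlMr // mulrBl divfK ?gt_eqF // => h1 h2.
have l1 : (a' j < a j)%N by rewrite -(ltr_nat R); lra.
have l2 : (a j < (a' j).+2)%N.
  by rewrite -(ltr_nat R); move: h2; rewrite -!natr1; lra.
have aE : a j = (a' j).+1 by apply/eqP; rewrite eqn_leq l1 -ltnS l2.
by have := ha j jk; rewrite aE; lia.
Qed.

Lemma line_in_one_skeleton n (x : E3) k (b : 'I_3 -> nat) :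
  (forall j, j != k -> x 0 j = (b j)%:R / 3 ^+ n.+1) ->
  (forall j, j != k -> cantor_corner n.+1 (b j) && (b j %% 3 == 2)%N) ->
  0 <= x 0 k < 1 -> one_skeleton n.+1 x.
Proof.
move=> xE hb /andP[x0 x1].
set q : R := 3 ^+ n.+1 in xE *.
have q0 : 0 < q by rewrite exprn_gt0.
have xq0 : 0 <= x 0 k * q by rewrite mulr_ge0 // ltW.
(* Along the line, the cube is found by rounding down; [x 0 k < 1] keeps it inside the unit cube. *)
pose a : {ffun 'I_3 -> nat} :=
  [ffun j => if j == k then Num.truncn (x 0 k * q) else b j].
have ak : a k = Num.truncn (x 0 k * q) by rewrite ffunE eqxx.
have aj j : j != k -> a j = b j by move=> jk; rewrite ffunE (negbTE jk).
have ma : menger_corner n.+1 a.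
  apply: (@menger_corner_line _ _ k) => [j jk|].
    by rewrite aj //; have /andP[] := hb j jk.
  by rewrite ak truncn_lt_nat // natrX -/q -ltr_pdivlMr // divff ?gt_eqF.
exists a, k, (fun=> false); split => //.
  apply: cube_edge_boundary => // j jk.
  by rewrite aj //; have /andP[_ /eqP] := hb j jk.
split; last by move=> j jk; rewrite addn0 aj // xE.
move=> i; rewrite -/q; have [->|ik] := eqVneq i k.
  by rewrite ak ler_pdivrMr // ler_pdivlMr // -truncn_ge_nat // leqnn /= ltW // truncnS_gt.
by rewrite aj // xE // lexx ler_pM2r ?invr_gt0 // ler_nat leqnSn.
Qed.

End MengerEdges.

(** * The Cantor grid *)

Section CantorGrid.
Variable R : realType.
Local Notation E3 := 'rV[R]_3.
Local Notation edge := (E3 * E3)%type.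

(** The coordinates of all vertices, in all three directions together, are sorted, and one
    increasing map [f] sends the [j]-th of them to the Cantor number [y j]. Equal coordinates stay
    equal, so edges remain parallel to their axes. *)
Lemma axis_parallel_in_one_skeleton (L : seq edge) :
  {in L, forall S, axis_parallel S} ->
  exists n C, C `<=` @one_skeleton R n /\ ambient_isotopic (body L) C.
Proof.
move=> axL.
have [B0|/set0P B0] := eqVneq (body L) set0.
  by exists 0%N, (body L); rewrite {1}B0; split => //; exact: ambient_isotopic_refl.
pose rs := sort <=%O (undup [seq (x : E3) 0 i | x <- unzip1 L ++ unzip2 L,
                                                i <- enum 'I_3]).
have memrs (x : E3) i : x \in unzip1 L ++ unzip2 L -> x 0 i \in rs.
  move=> xL; rewrite mem_sort mem_undup; apply/allpairsP.
  by exists (x, i); rewrite mem_enum.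
have mem1 S i : S \in L -> S.1 0 i \in rs.
  by move=> SL; apply: memrs; rewrite mem_cat map_f.
have mem2 S i : S \in L -> S.2 0 i \in rs.
  by move=> SL; apply: memrs; rewrite mem_cat map_f ?orbT.
have srs : sorted <%O rs by rewrite sort_lt_sorted undup_uniq.
pose n := size rs.
(* The ternary digits of b j are 0 and 2 only, and its last digit is 2. *)
pose b j := (2 * 3 ^ j.+1 + 2)%N.
pose q : R := 3 ^+ n.+1.
have q0 : 0 < q by rewrite exprn_gt0.
pose y j := (b j)%:R / q.
have ysmall j : (j < n)%N -> 0 <= y j < 1.
  move=> jn; rewrite divr_ge0 ?ler0n ?(ltW q0) //= ltr_pdivrMr // mul1r.
  (* One level more than the number of coordinates leaves room for the extra last digit 2:
     [2 * 3 ^ j.+1 + 2 < 3 ^ j.+2]. *)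
  rewrite /q -natrX ltr_nat; apply: (@leq_trans (3 ^ j.+2)); last first.
    by rewrite leq_exp2l.
  rewrite /b (expnS 3 j.+1); have : (3 ^ 1 <= 3 ^ j.+1)%N by rewrite leq_exp2l.
  by lia.
have [||f [c [C [c0 fcC fr]]]] := @interpolation R (nth 0 rs) y n.-1.
- by move=> j jn; apply: (sortedP 0 srs); move: jn; rewrite -/n; lia.
- move=> j _; rewrite /y ltr_pM2r ?invr_gt0 // ltr_nat /b ltn_add2r.
  by rewrite ltn_pmul2l // ltn_exp2l.
have fE x : x \in rs -> f x = y (index x rs) /\ (index x rs < n)%N.
  move=> xr; have xn : (index x rs < n)%N by rewrite index_mem.
  split => //; rewrite -{1}(nth_index 0 xr) fr //.
  by rewrite -ltnS prednK // (leq_ltn_trans _ xn).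
have fmono x z : x <= z -> f x <= f z.
  move=> xz; have /andP[h _] := fcC x z xz; rewrite -subr_ge0.
  by apply: le_trans h; rewrite mulr_ge0 ?(ltW c0) // subr_ge0.
have f01 x : x \in rs -> 0 <= f x < 1.
  by move=> /fE [-> xn]; exact: ysmall.
exists n.+1, ((fun x : E3 => \row_i f (x 0 i)) @` body L); split; last first.
  exact: isotopic_coordinatewise c0 fcC.
move=> _ [z [S SL [s /andP[s0 s1] zE]] <-].
have [k Sk] := axL S SL.
have zi i : z 0 i = S.1 0 i + s * (S.2 0 i - S.1 0 i) by rewrite zE !mxE.
apply: (@line_in_one_skeleton _ _ _ k (fun j => b (index (S.1 0 j) rs))).
- move=> j jk; rewrite mxE zi -(Sk j jk) subrr mulr0 addr0.
  by have [-> _] := fE _ (mem1 S j SL).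
- move=> j jk; have [_ hj] := fE _ (mem1 S j SL).
  set m := index _ _ in hj *.
  have -> : b m = (2 * 3 ^ m * 3 + 2)%N by rewrite /b expnS mulnCA mulnC.
  by rewrite /= divnMDl // addn0 modnMDl andbT cantor_corner_pow3.
- rewrite mxE.
  (* Only coordinate [k] varies along the edge; by monotonicity its image stays between the images
     of the endpoints, hence in [[0, 1[]. *)
  have /andP[f10 f11] := f01 _ (mem1 S k SL).
  have /andP[f20 f21] := f01 _ (mem2 S k SL).
  have [le12|le21] := leP (S.1 0 k) (S.2 0 k).
    apply/andP; split.
      by apply: le_trans f10 (fmono _ _ _); rewrite zi lerDl mulr_ge0 // subr_ge0.
    apply: le_lt_trans (fmono _ _ _) f21; rewrite zi.
    have : 0 <= (1 - s) * (S.2 0 k - S.1 0 k) by rewrite mulr_ge0 // subr_ge0.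
    lra.
  have d12 : 0 <= S.1 0 k - S.2 0 k by rewrite subr_ge0 ltW.
  have d1 : 0 <= s * (S.1 0 k - S.2 0 k) by rewrite mulr_ge0.
  have d2 : 0 <= (1 - s) * (S.1 0 k - S.2 0 k) by rewrite mulr_ge0 // subr_ge0.
  apply/andP; split.
    by apply: le_trans f20 (fmono _ _ _); rewrite zi; lra.
  by apply: le_lt_trans (fmono _ _ _) f11; rewrite zi; lra.
Qed.

End CantorGrid.

Theorem theorem1 (R : realType) (K : set 'rV[R]_3) (hK : tame_knot K) :
  exists (n : nat) (C : set 'rV[R]_3),
    [/\ simple_closed_curve C,
        C `<=` one_skeleton n &
        ambient_isotopic K C].
Proof.
have [sK [P [/simple_closed_polygon_complex [L cL ->] KL]]] := hK.
have [L' LL' axL'] := complex_axis_parallel cL.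
have [n [C [Cn L'C]]] := axis_parallel_in_one_skeleton axL'.
have KC := ambient_isotopic_trans KL (ambient_isotopic_trans LL' L'C).
(* That [C] is a simple closed curve is inherited from [K] through the isotopy. *)
by exists n, C; split => //; exact: simple_closed_curve_isotopic sK KC.
Qed.
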